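(* Let $q$ be a distribution on $(0,1)$ and let the initial data $u_0,u_1$ be distributions on $(0,1)$; fix $T>0$. Then the initial/boundary problem $$\partial_t^2u(t,x)-\partial_x^2u(t,x)+q(x)u(t,x)=0,\ (t,x)\in[0,T]\times(0,1),\quad u(0,x)=u_0(x),\ \partial_tu(0,x)=u_1(x),\quad u(t,0)=0=u(t,1),$$ has a very weak solution.
   Context: Nets are indexed by $\varepsilon\in(0,1]$. A net of functions $(u_\varepsilon)$ is $L^2$-moderate if there exist $N\in\mathbb{N}_0$ and $C>0$ with $\|u_\varepsilon\|_{L^2}\le C\varepsilon^{-N}$ (for nets $u_\varepsilon(t,x)$ depending on $t\in[0,T]$, $\|u_\varepsilon(t,\cdot)\|_{L^2}\le C\varepsilon^{-N}$ uniformly in $t$). A net $(q_\varepsilon)$ is $L^\infty$-moderate if there exist $N\in\mathbb{N}_0$, $C>0$ with $\|q_\varepsilon\|_{L^\infty}\le C\varepsilon^{-N}$. A regularisation of a distribution is a net of smooth functions on $(0,1)$ approximating it (e.g. obtained by convolution with a mollifier $\psi_\varepsilon(x)=\varepsilon^{-1}\psi(x/\varepsilon)$, $\psi\in C_0^\infty(\mathbb{R})$, $\int\psi=1$). A net $(u_\varepsilon)_{\varepsilon>0}$ is a very weak solution of the problem if there exist an $L^\infty$-moderate regularisation $(q_\varepsilon)$ of $q$ and $L^2$-moderate regularisations $(u_{0,\varepsilon})$, $(u_{1,\varepsilon})$ of $u_0,u_1$ such that for each $\varepsilon$, $u_\varepsilon$ solves $\partial_t^2u_\varepsilon-\partial_x^2u_\varepsilon+q_\varepsilon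 u_\varepsilon=0$ on $[0,T]\times(0,1)$ with $u_\varepsilon(0,\cdot)=u_{0,\varepsilon}$, $\partial_tu_\varepsilon(0,\cdot)=u_{1,\varepsilon}$, $u_\varepsilon(t,0)=0=u_\varepsilon(t,1)$, and both $(u_\varepsilon)$ and $(\partial_tu_\varepsilon)$ are $L^2$-moderate. *)

(* Defs.v *)
From HB Require Import structures.
From mathcomp Require Import all_boot all_order all_algebra.
From mathcomp Require Import all_classical all_reals all_analysis.
Set Implicit Arguments. Unset Strict Implicit. Unset Printing Implicit Defensive.
Import Order.TTheory GRing.Theory Num.Theory.
Import numFieldNormedType.Exports.
Local Open Scope classical_set_scope.
Local Open Scope ring_scope.

Section Defs.
Variable R : realType.

Definition I01 : set R := `]0, 1[%classic.
Definition epsrange : set R := `]0, 1]%classic.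

Definition smooth_on (A : set R) (f : R -> R) : Prop :=
  forall (n : nat) (x : R), A x -> derivable (derive1n n f) x 1.

Definition supported_in (a b : R) (phi : R -> R) : Prop :=
  forall x, ~ (a <= x <= b) -> phi x = 0.

Definition test_function (phi : R -> R) : Prop :=
  smooth_on setT phi /\
  exists a b : R, [/\ 0 < a, a <= b, b < 1 & supported_in a b phi].

Definition supnorm_deriv (j : nat) (phi : R -> R) : R :=
  sup [set `|(derive1n j phi) x| | x in [set: R]].

(* distributions on (0,1): linear functionals on C_c^infty((0,1)) that are
   continuous, i.e. satisfy the usual seminorm estimate on each compact *)
Definition distribution01 (u : (R -> R) -> R) : Prop :=
  (forall (phi psi : R -> R) (c : R), test_function phi -> test_function psi ->
      u (fun x => phi x + c * psi x) = u phi + c * u psi) /\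
  (forall a b : R, 0 < a -> a <= b -> b < 1 ->
     exists (C : R) (k : nat), forall phi, test_function phi ->
       supported_in a b phi ->
       `|u phi| <= C * \sum_(j < k.+1) supnorm_deriv j phi).

Definition regularisation (u : (R -> R) -> R) (f : R -> R -> R) : Prop :=
  (forall e, epsrange e -> smooth_on I01 (f e)) /\
  (forall phi, test_function phi ->
     (fun e => \int[lebesgue_measure]_(x in I01) (f e x * phi x))
       @ (0:R)^'+ --> u phi).

Definition L2_le (g : R -> R) (M : R) : Prop :=
  (\int[lebesgue_measure]_(x in I01) ((g x) ^+ 2)%:E <= (M ^+ 2)%:E)%E.

Definition L2_moderate (f : R -> R -> R) : Prop :=
  exists (N : nat) (C : R), 0 < C /\
    forall e, epsrange e -> L2_le (f e) (C * e ^- N).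

Definition L2_moderate_t (T : R) (u : R -> R -> R -> R) : Prop :=
  exists (N : nat) (C : R), 0 < C /\
    forall e, epsrange e -> forall t, 0 <= t <= T ->
      L2_le (u e t) (C * e ^- N).

Definition Linf_moderate (f : R -> R -> R) : Prop :=
  exists (N : nat) (C : R), 0 < C /\
    forall e, epsrange e -> forall x, I01 x -> `|f e x| <= C * e ^- N.

Definition dt (w : R -> R -> R) : R -> R -> R :=
  fun t x => derive1 (fun s => w s x) t.
Definition dx (w : R -> R -> R) : R -> R -> R :=
  fun t x => derive1 (fun y => w t y) x.

Definition solves (T : R) (qe u0e u1e : R -> R) (w : R -> R -> R) : Prop :=
  [/\ (forall t x, 0 <= t <= T -> I01 x ->
         [/\ derivable (fun s => w s x) t 1,
             derivable (fun s => dt w s x) t 1,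
             derivable (fun y => w t y) x 1,
             derivable (fun y => dx w t y) x 1 &
             dt (dt w) t x - dx (dx w) t x + qe x * w t x = 0]),
      (forall x, I01 x -> w 0 x = u0e x /\ dt w 0 x = u1e x) &
      (forall t, 0 <= t <= T ->
         (fun y => w t y) @ (0:R)^'+ --> (0:R) /\
         (fun y => w t y) @ (1:R)^'- --> (0:R))].

Definition very_weak_solution (T : R) (q u0 u1 : (R -> R) -> R)
    (u : R -> R -> R -> R) : Prop :=
  exists qe u0e u1e : R -> R -> R,
    [/\ regularisation q qe /\ Linf_moderate qe,
        regularisation u0 u0e /\ L2_moderate u0e,
        regularisation u1 u1e /\ L2_moderate u1e,
        (forall e, epsrange e -> solves T (qe e) (u0e e) (u1e e) (u e)) &
        L2_moderate_t T u /\ L2_moderate_t T (fun e => dt (u e))].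

End Defs.

(* Main.v *)
Require Import Defs.
From HB Require Import structures.
From mathcomp Require Import all_boot all_order all_algebra.
From mathcomp Require Import all_classical all_reals all_analysis.
From mathcomp Require Import ring lra.
Import Order.TTheory GRing.Theory Num.Theory.
Import numFieldNormedType.Exports.
Set Implicit Arguments. Unset Strict Implicit. Unset Printing Implicit Defensive.
Local Open Scope classical_set_scope.
Local Open Scope ring_scope.

(** Since the regularisation may be chosen, quantitative energy estimates are
not needed: if a sequence of bounded data converges weakly to [(q, u0, u1)] and
the [n]-th problem has a bounded solution with bounded time derivative, then
letting the index [n] grow slowly enough as [e] tends to [0] makes every net
moderate.

Such data are found among trigonometric polynomials. A distribution is a weak
limit of finite combinations of Dirac masses: [phi] is the limit, together with
all derivatives, of [sum_i phi (x_i) (Psi (x_(i+1) - y) - Psi (x_i - y))], where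
[Psi] is a smooth step much wider than the mesh; this is local, so that the order
of the distribution near the endpoints plays no role. Each Dirac mass is in turn
approximated by Landau kernels, polynomials in [cos (pi x)], multiplied by
[sin (pi x)] for the initial data.

For such data the problem is solved by the Dyson series in powers of [q]. Its
[j]-th term is a sine sum with at most [L + j D] frequencies whose coefficients
solve forced oscillator equations and are bounded by [theta^j exp (k |t|)] with
[theta] as small as desired; the factor [theta^j] absorbs the powers of the
frequency produced by the derivatives in [x]. *)

(** * Calculus *)

(** The constants of the approximating problems may depend on the index in any way, so the real task
    is to make each of these problems explicitly solvable. Polynomials in cos (pi x) achieve this:
    multiplication by cos (pi x) acts on sine coefficients as a tridiagonal operator that does not
    increase their supremum and adds a single frequency. Finite sine sums, which satisfy the
    boundary condition by themselves, are therefore preserved at every order of the Dyson series,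
    and compatibility of the data with the boundary never becomes an issue.

    The derivatives in [solves] are two-sided, also at the times 0 and [T]. The solutions are
    therefore built for all real times and measured against the weight exp (k |t|). In this weight
    one integration in time gains the factor 1/k, so that a large k makes the series converge
    geometrically whatever the size of the potential and the length of the time interval.

    The Dirac coefficients and the kernels must be fixed before any test function is known. This is
    why the errors are always expressed through bounds on finitely many derivatives of the test
    function, multiplied by a quantity that tends to 0 independently of it. *)

Section Calculus.
Variable R : realType.
Implicit Types (f g : R -> R) (x a b : R).

Lemma is_derive_add f g x a b : is_derive x 1 f a -> is_derive x 1 g b ->
  is_derive x 1 (fun y => f y + g y) (a + b).
Proof. by move=> ? ?; exact: is_deriveD. Qed.

Lemma is_derive_opp f x a : is_derive x 1 f a ->
  is_derive x 1 (fun y => - f y) (- a).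
Proof. by move=> ?; exact: is_deriveN. Qed.

Lemma is_derive_sub f g x a b : is_derive x 1 f a -> is_derive x 1 g b ->
  is_derive x 1 (fun y => f y - g y) (a - b).
Proof. by move=> ? ?; exact: is_deriveB. Qed.

Lemma is_derive_mul f g x a b : is_derive x 1 f a -> is_derive x 1 g b ->
  is_derive x 1 (fun y => f y * g y) (a * g x + f x * b).
Proof.
move=> fa gb; apply: (is_derive_eq (is_deriveM fa gb)).
by rewrite /GRing.scale /= addrC [g x * a]mulrC.
Qed.

Lemma is_derive_scale f x a (k : R) : is_derive x 1 f a ->
  is_derive x 1 (fun y => k * f y) (k * a).
Proof. by move=> fa; exact: is_deriveZ. Qed.

Lemma is_derive_affine f x a (k c : R) : is_derive (k * x + c) 1 f a ->
  is_derive x 1 (fun y => f (k * y + c)) (k * a).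
Proof.
move=> fa.
have gk : is_derive x 1 (fun y => k * y + c) k.
  apply: (is_derive_eq (is_derive_add (is_derive_scale k (is_derive_id x 1))
    (is_derive_cst c x 1))).
  by rewrite mulr1 addr0.
apply: (is_derive_eq (@is_derive1_comp _ f (fun y => k * y + c) x a k fa gk)).
by rewrite mulrC.
Qed.

Lemma is_derive_bigsum (I : Type) (r : seq I) (P : pred I) (F : I -> R -> R)
    (dF : I -> R) x : (forall i, is_derive x 1 (F i) (dF i)) ->
  is_derive x 1 (fun y => \sum_(i <- r | P i) F i y) (\sum_(i <- r | P i) dF i).
Proof.
move=> FdF; elim: r => [|i r IH].
  rewrite big_nil; under eq_fun do rewrite big_nil.
  exact: is_derive_cst.
rewrite big_cons; under eq_fun do rewrite big_cons.
by case: (P i) => //; exact: is_derive_add.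
Qed.

Lemma is_derive_continuous f x a : is_derive x 1 f a -> {for x, continuous f}.
Proof.
by move=> [df _]; apply/differentiable_continuous; exact/derivable1_diffP.
Qed.

Lemma is_derive_derive1 f x a : is_derive x 1 f a -> derive1 f x = a.
Proof. by move=> [_ <-]; rewrite derive1E. Qed.

Lemma derivable_is_derive f x : derivable f x 1 -> is_derive x 1 f (derive1 f x).
Proof. by move=> /derivableP; rewrite derive1E. Qed.

Lemma is_derive_MVT f g a b : a <= b ->
  (forall x, a <= x <= b -> is_derive x 1 f (g x)) ->
  exists2 c, a <= c <= b & f b - f a = g c * (b - a).
Proof.
move=> ab fg; have [] := @MVT_segment R f g a b ab.
- by move=> x /[!in_itv]/= /andP[ax xb]; apply: fg; rewrite !ltW.
- apply: continuous_in_subspaceT => x; rewrite inE/= in_itv/= => xab.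
  exact: is_derive_continuous (fg _ xab).
by move=> c; rewrite in_itv/= => cab fE; exists c.
Qed.

Lemma is_derive_lip f g a b (K : R) :
  (forall x, Num.min a b <= x <= Num.max a b ->
     is_derive x 1 f (g x) /\ `|g x| <= K) ->
  `|f b - f a| <= K * `|b - a|.
Proof.
wlog ab : a b / a <= b.
  move=> H; case/orP: (le_total a b) => [ab|ba]; first exact: H.
  by rewrite minC maxC distrC [X in _ * X]distrC; exact: H.
rewrite (min_idPl ab) (max_idPr ab) => fg.
have [|c cab ->] := @is_derive_MVT f g a b ab; first by move=> x /fg[].
by rewrite normrM ler_wpM2r// (fg _ cab).2.
Qed.

(** The mean value inequality is applied twice: to [g], and then to [f y - g a * y], whose
    derivative [g x - g a] is thus at most [K * |b - a|]. The factor 1/2 of Taylor's formula is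
    given up. *)
Lemma is_derive_taylor2 f g h a b (K : R) :
  (forall x, is_derive x 1 f (g x)) -> (forall x, is_derive x 1 g (h x)) ->
  (forall x, `|h x| <= K) ->
  `|f b - f a - g a * (b - a)| <= K * `|b - a| ^+ 2.
Proof.
move=> fg gh hK.
have D x : is_derive x 1 (fun y => f y - g a * y) (g x - g a).
  apply: is_derive_sub => //.
  by apply: (is_derive_eq (is_derive_scale (g a) (is_derive_id x 1))); rewrite mulr1.
have := @is_derive_lip (fun y => f y - g a * y) (fun x => g x - g a) a b
  (K * `|b - a|).
rewrite expr2 mulrA.
have -> : f b - g a * b - (f a - g a * a) = f b - f a - g a * (b - a) by ring.
apply=> x xab; split => //.
apply: (le_trans (@is_derive_lip g h a x K _)) => [y _|]; first by split.
apply: ler_wpM2l; first exact: le_trans (normr_ge0 _) (hK 0).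
move: xab; case: (leP a b) => ab /andP[ax xb].
  by rewrite !ger0_norm ?subr_ge0//; lra.
by rewrite !ler0_norm ?subr_le0//; lra.
Qed.

(** Meant for the point 0 of the flat function below, where the formulas on the two sides differ and
    no differentiation rule applies. *)
Lemma is_derive_quadratic f x a (K : R) :
  (forall y, `|y - x| <= 1 -> `|f y - f x - a * (y - x)| <= K * `|y - x| ^+ 2) ->
  is_derive x 1 f a.
Proof.
move=> H.
have K0 : 0 <= K.
  have := H (x + 1); have -> : x + 1 - x = 1 by ring.
  rewrite normr1 expr1n !mulr1 => /(_ (lexx _)).
  exact: (le_trans (normr_ge0 _)).
have L : h^-1 *: (f (h *: 1 + x) - f x) @[h --> 0^'] --> a.
  apply/cvgrPdist_le => e e0; near=> h.
  have h0 : h != 0 by near: h; exact: nbhs_dnbhs_neq.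
  have h1 : `|h| <= 1.
    by near: h; apply: dnbhs0_le.
  have he : `|h| <= e / (K + 1).
    by near: h; apply: dnbhs0_le; rewrite divr_gt0// ltr_wpDl.
  rewrite /GRing.scale /= mulr1 distrC.
  have -> : h^-1 * (f (h + x) - f x) - a = h^-1 * (f (h + x) - f x - a * (h + x - x)).
    by field.
  rewrite normrM normfV ler_pdivrMl ?normr_gt0//.
  apply: (le_trans (H _ _)); rewrite addrK// expr2 mulrCA ler_wpM2l//.
  apply: (@le_trans _ _ ((K + 1) * `|h|)); first by rewrite ler_wpM2r// lerDl.
  by rewrite mulrC -ler_pdivlMr// ltr_wpDl.
split; first by apply/cvg_ex; exists a.
exact: (cvg_lim (@norm_hausdorff _ _) L).
Unshelve. all: by end_near. Qed.

End Calculus.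

Section Primitive.
Variable R : realType.

Lemma continuous_integrable_itv (g : R -> R) (a b : R) : continuous g ->
  lebesgue_measure.-integrable `[a, b] (EFin \o g).
Proof.
move=> cg; apply: continuous_compact_integrable; first exact: segment_compact.
exact: continuous_subspaceT.
Qed.

(** The integral from 0 is signed, so it is defined by cases. On each ball of radius [M] it differs
    by a constant from the integral based at [- M], to which the fundamental theorem applies without
    any distinction at 0. *)
Lemma exists_primitive (g : R -> R) : continuous g ->
  exists2 F : R -> R, F 0 = 0 & forall x : R, is_derive x 1 F (g x).
Proof.
move=> cg.
pose P M t := \int[@lebesgue_measure R]_(x in `[- M, t]) g x.
pose F t := if 0 <= t then \int[@lebesgue_measure R]_(x in `]0, t]) g x
            else - \int[@lebesgue_measure R]_(x in `]t, 0]) g x.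
have FP M t : `|t| < M -> F t = P M t - P M 0.
  move=> tM; have M0 : 0 < M by apply: le_lt_trans tM.
  have := tM; rewrite ltr_norml => /andP[Mt tM'].
  rewrite /F /P; case: ifPn => [t0|]; last rewrite -ltNge => t0.
    by rewrite Rintegral_itvB ?bnd_simp//; [exact: continuous_integrable_itv|lra].
  rewrite -[RHS]opprB Rintegral_itvB ?bnd_simp//; last by lra.
    exact: continuous_integrable_itv.
  exact: ltW.
exists F => [|x].
  by rewrite /F lexx set_itvoc0 Rintegral_set0.
have [] := @continuous_FTC1_closed _ g (- (`|x| + 1)) x (x + 1).
- by lra.
- exact: continuous_integrable_itv.
- by have := lerNnormlW (lexx `|x|); lra.
- exact: cg.
move=> dP gP.
have D : is_derive x 1 (fun t => P (`|x| + 1) t - P (`|x| + 1) 0) (g x).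
  have := is_derive_sub (derivable_is_derive dP) (is_derive_cst (P (`|x| + 1) 0) x 1).
  by rewrite gP subr0.
apply: (near_eq_is_derive _ D); near=> t; apply/esym/FP.
rewrite -(subrK x t) (le_lt_trans (ler_normD _ _))// addrC ltrD2l.
near: t; apply/nbhs_normP; exists 1 => //= y /=.
by rewrite distrC.
Unshelve. all: by end_near. Qed.

End Primitive.

Section Smooth.
Variable R : realType.
Implicit Types (f g : R -> R).

Lemma derive1nSr n f : derive1n n.+1 f = derive1n n (derive1 f).
Proof. by rewrite /derive1n iterSr. Qed.

Lemma smooth_is_derive f n (x : R) : smooth_on setT f ->
  is_derive x 1 (derive1n n f) (derive1n n.+1 f x).
Proof. by move=> sf; rewrite derive1nS; apply: derivable_is_derive; exact: sf. Qed.

Lemma smooth_derive1n f n : smooth_on setT f -> smooth_on setT (derive1n n f).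
Proof.
by move=> sf m x _; rewrite /derive1n -iterD; exact: (sf (m + n)%N).
Qed.

Lemma smooth_continuous f : smooth_on setT f -> continuous f.
Proof. by move=> sf x; exact: is_derive_continuous (smooth_is_derive 0 x sf). Qed.

(** Exhibiting all successive derivatives at once, as a chain [F], replaces an induction on iterated
    derivatives in each of the smoothness proofs that follow. *)
Lemma derive1n_chain (F : nat -> R -> R) n :
  (forall n (x : R), is_derive x 1 (F n) (F n.+1 x)) -> derive1n n (F 0%N) = F n.
Proof.
move=> dF; elim: n => // n IH.
by rewrite derive1nS IH; apply/funext => x; exact: is_derive_derive1.
Qed.

Lemma smooth_chain (F : nat -> R -> R) :
  (forall n (x : R), is_derive x 1 (F n) (F n.+1 x)) -> smooth_on setT (F 0%N).
Proof.
by move=> dF n x _; rewrite derive1n_chain//; have [] := dF n x.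
Qed.

Lemma derive1n_add f g n : smooth_on setT f -> smooth_on setT g ->
  derive1n n (fun x => f x + g x) = fun x => derive1n n f x + derive1n n g x.
Proof.
move=> sf sg.
apply: (@derive1n_chain (fun n x => derive1n n f x + derive1n n g x)) => m x.
by apply: is_derive_add; exact: smooth_is_derive.
Qed.

Lemma smooth_add f g : smooth_on setT f -> smooth_on setT g ->
  smooth_on setT (fun x => f x + g x).
Proof.
move=> sf sg.
apply: (@smooth_chain (fun n x => derive1n n f x + derive1n n g x)) => m x.
by apply: is_derive_add; exact: smooth_is_derive.
Qed.

Lemma derive1n_scale (k : R) f n : smooth_on setT f ->
  derive1n n (fun x => k * f x) = fun x => k * derive1n n f x.
Proof.
move=> sf; apply: (@derive1n_chain (fun n x => k * derive1n n f x)) => m x.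
by apply: is_derive_scale; exact: smooth_is_derive.
Qed.

Lemma smooth_scale (k : R) f : smooth_on setT f ->
  smooth_on setT (fun x => k * f x).
Proof.
move=> sf; apply: (@smooth_chain (fun n x => k * derive1n n f x)) => m x.
by apply: is_derive_scale; exact: smooth_is_derive.
Qed.

Let affine_chain (k c : R) f (sf : smooth_on setT f) m (x : R) :
  is_derive x 1 (fun x => k ^+ m * derive1n m f (k * x + c))
    (k ^+ m.+1 * derive1n m.+1 f (k * x + c)).
Proof.
rewrite exprSr -mulrA; apply: is_derive_scale.
by apply: is_derive_affine; exact: smooth_is_derive.
Qed.

Lemma derive1n_affine (k c : R) f n : smooth_on setT f ->
  derive1n n (fun x => f (k * x + c)) =
  fun x => k ^+ n * derive1n n f (k * x + c).
Proof.
move=> sf; rewrite -(derive1n_chain n (affine_chain k c sf)).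
by congr derive1n; apply/funext => x; rewrite expr0 mul1r.
Qed.

Lemma smooth_affine (k c : R) f : smooth_on setT f ->
  smooth_on setT (fun x => f (k * x + c)).
Proof.
move=> sf; have := smooth_chain (affine_chain k c sf).
by under eq_fun do rewrite expr0 mul1r.
Qed.

Lemma derive1n_sum (I : Type) (r : seq I) (F : I -> R -> R) n :
  (forall i, smooth_on setT (F i)) ->
  derive1n n (fun x => \sum_(i <- r) F i x) =
  fun x => \sum_(i <- r) derive1n n (F i) x.
Proof.
move=> sF.
apply: (@derive1n_chain (fun n x => \sum_(i <- r) derive1n n (F i) x)) => m x.
by apply: is_derive_bigsum => i; exact: smooth_is_derive.
Qed.

Lemma smooth_sum (I : Type) (r : seq I) (F : I -> R -> R) :
  (forall i, smooth_on setT (F i)) ->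
  smooth_on setT (fun x => \sum_(i <- r) F i x).
Proof.
move=> sF.
apply: (@smooth_chain (fun n x => \sum_(i <- r) derive1n n (F i) x)) => m x.
by apply: is_derive_bigsum => i; exact: smooth_is_derive.
Qed.

Lemma smooth_cst (c : R) : smooth_on setT (cst c : R -> R).
Proof.
by apply: (@smooth_chain (fun n => if n is _.+1 then cst 0 else cst c))
  => -[|m] x; exact: is_derive_cst.
Qed.

Lemma smooth_cos : smooth_on setT (@cos R).
Proof.
have -> : @cos R = fun x => cos (x + pi / 2 *+ 0).
  by apply/funext => x; rewrite mulr0n addr0.
apply: (@smooth_chain (fun n x => cos (x + pi / 2 *+ n))) => n x.
have := @is_derive_affine R (@cos R) x _ 1 (pi / 2 *+ n) (is_derive_cos _).
under eq_fun do rewrite mul1r.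
by rewrite !mul1r [_ *+ n.+1]mulrSr addrA cosDpihalf.
Qed.

Lemma smooth_sin : smooth_on setT (@sin R).
Proof.
have -> : @sin R = fun x => cos (1 * x + - (pi / 2)).
  by apply/funext => x; rewrite mul1r cosBpihalf.
by apply: smooth_affine; exact: smooth_cos.
Qed.

(* Leibniz' rule doubles the number of products at every derivation, so the
   induction is on the order of differentiability of all products at once. *)
Lemma smooth_mul f g : smooth_on setT f -> smooth_on setT g ->
  smooth_on setT (fun x => f x * g x).
Proof.
pose nd n f := forall m (x : R), (m <= n)%N -> derivable (derive1n m f) x (1 : R).
have ndS n (h : R -> R) : (forall x : R, derivable h x 1) -> nd n (derive1 h) -> nd n.+1 h.
  by move=> h1 h2 [|m] x mn; [exact: h1|rewrite derive1nSr; exact: h2].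
have ndD n : forall f g, nd n f -> nd n g -> nd n (fun x => f x + g x).
  elim: n => [|n IH] f1 g1 nf ng.
    by move=> [|//] x _; apply: derivableD; [exact: (nf 0%N)|exact: (ng 0%N)].
  apply: ndS => [x|]; first by apply: derivableD; [exact: (nf 0%N)|exact: (ng 0%N)].
  have -> : derive1 (fun x => f1 x + g1 x) = fun x => derive1 f1 x + derive1 g1 x.
    apply/funext => x; apply: is_derive_derive1; apply: is_derive_add.
      by apply: derivable_is_derive; exact: (nf 0%N).
    by apply: derivable_is_derive; exact: (ng 0%N).
  by apply: IH => m x mn; rewrite -derive1nSr; [exact: nf|exact: ng].
suff ndM n : forall f g, smooth_on setT f -> smooth_on setT g ->
    nd n (fun x => f x * g x).
  by move=> sf sg n x _; exact: (ndM n).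
elim: n => [|n IH] f1 g1 sf sg.
  by move=> [|//] x _; apply: derivableM; [exact: (sf 0%N)|exact: (sg 0%N)].
apply: ndS => [x|]; first by apply: derivableM; [exact: (sf 0%N)|exact: (sg 0%N)].
have -> : derive1 (fun x => f1 x * g1 x) =
    fun x => derive1 f1 x * g1 x + f1 x * derive1 g1 x.
  apply/funext => x; apply: is_derive_derive1; apply: is_derive_mul.
    by apply: derivable_is_derive; exact: (sf 0%N).
  by apply: derivable_is_derive; exact: (sg 0%N).
by apply: ndD; apply: IH => //; exact: (@smooth_derive1n _ 1).
Qed.

Lemma smooth_horner (p : {poly R}) f : smooth_on setT f ->
  smooth_on setT (fun x => p.[f x]).
Proof.
move=> sf; elim/poly_ind: p => [|p c IH].
  by under eq_fun do rewrite horner0; exact: smooth_cst.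
under eq_fun do rewrite hornerMXaddC.
by apply: smooth_add; [exact: smooth_mul|exact: smooth_cst].
Qed.

End Smooth.

(** * Smooth steps *)

Section CompactSupport.
Variable R : realType.
Implicit Types (f : R -> R) (a b : R).

Lemma derive1_supported_in f a b :
  supported_in a b f -> supported_in a b (derive1 f).
Proof.
move=> fab x xab; apply: is_derive_derive1.
have [[xa|bx]|] : (x < a \/ b < x) \/ a <= x <= b.
- case: (ltP x a) => [|ax]; first by left; left.
  by case: (ltP b x) => [|xb]; [left; right|right].
- apply: near_eq_is_derive (is_derive_cst 0 x 1).
  near=> y; rewrite fab//; have : y < a by near: y; exact: lt_nbhsl.
  by move=> + /andP[]; lra.
- apply: near_eq_is_derive (is_derive_cst 0 x 1).
  near=> y; rewrite fab//; have : b < y by near: y; exact: lt_nbhsr.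
  by move=> + /andP[]; lra.
- by [].
Unshelve. all: by end_near. Qed.

Lemma derive1n_supported_in f a b n :
  supported_in a b f -> supported_in a b (derive1n n f).
Proof. by move=> fab; elim: n => //= n; exact: derive1_supported_in. Qed.

Lemma supported_in_bounded f a b : a <= b -> continuous f ->
  supported_in a b f -> exists K, forall x, `|f x| <= K.
Proof.
move=> ab cf fab.
have [|c _ cP] := @EVT_max R (fun x => `|f x|) a b ab.
  apply: continuous_subspaceT => x.
  by apply: continuous_comp; [exact: cf|exact: norm_continuous].
exists `|f c| => x; have [xab|xab] := pselect (a <= x <= b).
  by apply: cP; rewrite in_itv.
by rewrite fab// normr0.
Qed.

End CompactSupport.

Section FlatExponential.
Variable R : realType.

(* The functions [p(1/x) exp(-1/x)] on [x > 0], extended by 0, are closed under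
   derivation. *)
Definition flat (p : {poly R}) (x : R) : R :=
  if 0 < x then p.[x^-1] * expR (- x^-1) else 0.

Lemma horner_le_monomial (p : {poly R}) (s : R) : 1 <= s ->
  `|p.[s]| <= (\sum_(i < size p) `|p`_i|) * s ^+ size p.
Proof.
move=> s1; rewrite horner_coef mulr_suml.
apply: le_trans (ler_norm_sum _ _ _) _; apply: ler_sum => i _.
rewrite normrM normrX (ger0_norm (le_trans ler01 s1)).
by rewrite ler_wpM2l// ler_weXn2l// ltnW.
Qed.

(** With s = 1/h and d the size of [p], the polynomial is at most a constant times s^d, while exp s
    is at least s^(d+2)/(d+2)!; the two surplus powers of s give h^2. *)
Lemma flat_le_sqr (p : {poly R}) : exists K, forall h, `|h| <= 1 ->
  `|flat p h| <= K * `|h| ^+ 2.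
Proof.
set d := size p; set A := \sum_(i < size p) `|p`_i|.
have A0 : 0 <= A by apply: sumr_ge0.
exists (A * (d.+2)`!%:R) => h h1; rewrite /flat; case: ifPn => [h0|_]; last first.
  by rewrite normr0 mulr_ge0// mulr_ge0.
have s1 : 1 <= h^-1 by rewrite invf_ge1//; move: h1; rewrite gtr0_norm.
rewrite normrM (gtr0_norm (expR_gt0 _)) expRN (gtr0_norm h0).
rewrite ler_pdivrMr ?expR_gt0//.
apply: le_trans (horner_le_monomial p s1) _; rewrite -/d -/A -!mulrA ler_wpM2l//.
have E : h^-1 ^+ d.+2 / d.+2`!%:R <= expR h^-1.
  apply: le_trans (expR_ge1Dxn d.+1 _); last by rewrite ltW// invr_gt0.
  by rewrite lerDr.
rewrite -[X in X <= _](_ : d.+2`!%:R * (h ^+ 2 * (h^-1 ^+ d.+2 / d.+2`!%:R)) = _).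
  rewrite expr2 -[h * h * _]mulrA ler_wpM2l//.
  by rewrite (ler_pM2l h0) (ler_pM2l h0).
rewrite !exprVn -addn2 exprD; field.
by rewrite expf_neq0 ?lt0r_neq0// ltr0n fact_gt0.
Qed.

(** Both factors contribute 1/x^2: the derivative of p(1/x) is - p'(1/x)/x^2 and that of exp(-1/x)
    is exp(-1/x)/x^2, whence the polynomial X^2 (p - p'). At 0 the quadratic bound gives derivative
    0. *)
Lemma is_derive_flat (p : {poly R}) (x : R) :
  is_derive x 1 (flat p) (flat ('X^2 * (p - p^`())) x).
Proof.
have [x0|x0|->] := ltgtP x 0.
- rewrite /flat ltNge (ltW x0)/=; apply: near_eq_is_derive (is_derive_cst 0 x 1).
  near=> y; have y0 : y < 0 by near: y; exact: lt_nbhsl.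
  by rewrite /flat ltNge (ltW y0).
- have V : is_derive x 1 (fun y : R => y^-1) (- x ^- 2).
    have := @is_deriveV R id x 1 1.
    by rewrite /GRing.scale /= mulr1; apply=> //; rewrite lt0r_neq0.
  have W : is_derive x 1 (fun y => - y^-1) (x ^- 2).
    by rewrite -[x ^- 2]opprK; exact: is_derive_opp.
  have DE : is_derive x 1 (fun y => expR (- y^-1)) (expR (- x^-1) * x ^- 2).
    exact: (@is_derive1_comp _ expR).
  have DP : is_derive x 1 (fun y => p.[y^-1]) (p^`().[x^-1] * - x ^- 2).
    have DQ : is_derive x^-1 1 (horner p) p^`().[x^-1].
      have -> : p^`().[x^-1] = derive1 (horner p) x^-1 by rewrite -derivE.
      by apply: derivable_is_derive; exact: derivable_horner.
    exact: (is_derive1_comp DQ V).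
  apply: near_eq_is_derive; last first.
    apply: is_derive_eq (is_derive_mul DP DE) _.
    rewrite /flat x0 hornerM hornerD hornerN hornerXn exprVn; ring.
  near=> y; have y0 : 0 < y by near: y; exact: lt_nbhsr.
  by rewrite /flat y0.
- have [K HK] := flat_le_sqr p.
  apply: (@is_derive_quadratic _ _ _ _ K) => y; rewrite subr0 => /HK.
  by rewrite /flat ltxx mul0r !subr0.
Unshelve. all: by end_near. Qed.

Lemma smooth_flat : smooth_on setT (flat 1).
Proof.
apply: (@smooth_chain _ (fun n => flat (iter n (fun p => 'X^2 * (p - p^`())) 1))).
by move=> n x; exact: is_derive_flat.
Qed.

Lemma flat1_gt0 x : 0 < x -> 0 < flat 1 x.
Proof. by move=> x0; rewrite /flat x0 hornerC mul1r expR_gt0. Qed.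

Lemma flat1_ge0 x : 0 <= flat 1 x.
Proof. by have [x0|x0] := ltP 0 x; [exact/ltW/flat1_gt0|rewrite /flat ltNge x0]. Qed.

End FlatExponential.

Section SmoothStep.
Variable R : realType.

(** Monotonicity makes the weights [Psi (x_(i+1) - y) - Psi (x_i - y)] nonnegative; the bounds on
    all derivatives are what the mesh has to beat. *)
Definition step_function (w : R) (Psi : R -> R) : Prop :=
  [/\ smooth_on setT Psi, (forall x, x <= - w -> Psi x = 0),
      (forall x, w <= x -> Psi x = 1),
      {homo Psi : x y / x <= y} &
      forall n, exists K, forall x, `|derive1n n Psi x| <= K].

(** The step is the normalised primitive of the bump [flat 1 (1 + x) * flat 1 (1 - x)]; its
    derivatives of positive order are multiples of those of the bump, hence compactly supported and
    bounded. *)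
Lemma exists_unit_step : exists Psi, step_function 1 Psi.
Proof.
pose b x : R := flat 1 (1 * x + 1) * flat 1 (-1 * x + 1).
have sb : smooth_on setT b.
  by apply: smooth_mul; apply: smooth_affine; exact: smooth_flat.
have bs : supported_in (-1) 1 b.
  move=> x x11; rewrite /b /flat.
  case: ifPn => [h1|_]; last by rewrite mul0r.
  case: ifPn => [h2|_]; last by rewrite mulr0.
  by exfalso; apply: x11; apply/andP; split; lra.
have b0 x : 0 <= b x by rewrite mulr_ge0// flat1_ge0.
have [F _ FD] := exists_primitive (smooth_continuous sb).
have Fle x y : x <= y -> F x <= F y.
  move=> xy; have [c _] := @is_derive_MVT R F b x y xy (fun z _ => FD z).
  by rewrite -subr_ge0 => ->; rewrite mulr_ge0// subr_ge0.
(* The interval from [x] to [y] meets [-1, 1] at most in an end point, and the bump vanishes there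
   too. *)
have Fcst x y : x <= y -> (y <= -1 \/ 1 <= x) -> F x = F y.
  move=> xy xy1; apply/eqP; rewrite eq_sym -subr_eq0; apply/eqP.
  have h := @is_derive_lip R F b x y 0; apply/eqP.
  rewrite -normr_le0 -(mul0r `|y - x|); apply: h => z.
  rewrite (min_idPl xy) (max_idPr xy) => zxy; split => //.
  have [z11|z11] := pselect (-1 <= z <= 1); last by rewrite bs// normr0.
  have /andP[xz zy] := zxy; have /andP[z1 z1'] := z11.
  have : z = -1 \/ z = 1 by case: xy1 => ?; [left|right]; apply/eqP; rewrite eq_le; apply/andP; split; lra.
  case=> ->; rewrite /b /flat.
    by rewrite (_ : 1 * -1 + 1 = 0) ?ltxx ?mul0r ?normr0//; ring.
  by rewrite (_ : -1 * 1 + 1 = 0) ?ltxx ?mulr0 ?normr0//; ring.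
(* In case of equality the monotone [F] would be constant on [-1, 1], so its derivative [b 0] at 0
   would vanish. *)
have F1 : F (-1) < F 1.
  rewrite lt_neqAle Fle ?andbT; last by lra.
  apply/eqP => F11.
  have : is_derive (0:R) 1 F 0.
    apply: (near_eq_is_derive _ (is_derive_cst (F 1) (0:R) 1)).
    near=> x; have : `|x| <= 1.
      by near: x; apply/nbhs_normP; exists 1 => //= y /=; rewrite sub0r normrN => /ltW.
    by rewrite ler_norml => /andP[? ?]; apply/eqP; rewrite eq_le -{1}F11 !Fle.
  move/is_derive_derive1; rewrite (is_derive_derive1 (FD 0)) => b00.
  have : 0 < b 0 by rewrite /b mulr_gt0// flat1_gt0//; lra.
  by rewrite b00 ltxx.
pose k := (F 1 - F (-1))^-1.
have k0 : 0 < k by rewrite invr_gt0 subr_gt0.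
pose P x := k * (F x - F (-1)).
pose ch n := if n is m.+1 then fun x => k * derive1n m b x else P.
have chD n (x : R) : is_derive x 1 (ch n) (ch n.+1 x).
  case: n => [|n] /=; apply: is_derive_scale; last exact: smooth_is_derive.
  by have := is_derive_sub (FD x) (is_derive_cst (F (-1)) x 1); rewrite subr0.
have P0 x : x <= -1 -> P x = 0.
  by move=> x1; rewrite /P (Fcst _ _ x1 (or_introl (lexx _))) subrr mulr0.
have P1 x : 1 <= x -> P x = 1.
  move=> x1; rewrite /P -(Fcst _ _ x1 (or_intror (lexx _))) mulVf//.
  by rewrite lt0r_neq0// subr_gt0.
have Pm x y : x <= y -> P x <= P y.
  by move=> xy; rewrite ler_pM2l// lerB// Fle.
exists P; split => //; first exact: (smooth_chain chD).
case=> [|n].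
  exists 1 => x /=; rewrite ler_norml; apply/andP; split.
    have [x1|/ltW x1] := leP x (-1); first by rewrite P0//; lra.
    by have := Pm _ _ x1; rewrite (P0 _ (lexx _)); lra.
  have [x1|/ltW x1] := leP 1 x; first by rewrite P1//; lra.
  by have := Pm _ _ x1; rewrite (P1 _ (lexx _)); lra.
rewrite (derive1n_chain n.+1 chD) /=.
have le11 : -1 <= 1 :> R by lra.
have [K HK] := supported_in_bounded le11 (smooth_continuous (smooth_derive1n (n := n) sb))
  (derive1n_supported_in n bs).
by exists (k * K) => x; rewrite normrM (gtr0_norm k0) ler_pM2l.
Unshelve. all: by end_near. Qed.

Lemma exists_step (w : R) : 0 < w -> exists Psi, step_function w Psi.
Proof.
move=> w0; have [P [sP P0 P1 Pm Pb]] := exists_unit_step.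
exists (fun x => P (w^-1 * x + 0)); split => [|x xw|x wx|x y xy|n].
- exact: smooth_affine.
- by apply: P0; rewrite addr0 ler_pdivrMl// mulrN1.
- by apply: P1; rewrite addr0 ler_pdivlMl// mulr1.
- by apply: Pm; rewrite lerD2r ler_pM2l// invr_gt0.
have [K HK] := Pb n; exists (w^-1 ^+ n * K) => x.
rewrite derive1n_affine// normrM ger0_norm; last by rewrite exprn_ge0// invr_ge0 ltW.
by rewrite ler_wpM2l// exprn_ge0// invr_ge0 ltW.
Qed.

End SmoothStep.

(** * Weak approximation of distributions *)

Section TestFunctions.
Variable R : realType.
Implicit Types (f g phi : R -> R) (a b : R).

Lemma test_functionD f g (c : R) : test_function f -> test_function g ->
  test_function (fun x => f x + c * g x).
Proof.
move=> [sf [a [b [a0 ab b1 fab]]]] [sg [a' [b' [a0' ab' b1' gab]]]]; split.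
  by apply: smooth_add => //; exact: smooth_scale.
exists (Num.min a a'), (Num.max b b'); split.
- by rewrite lt_min a0.
- by rewrite ge_min le_max ab.
- by rewrite gt_max b1.
move=> x; rewrite ge_min le_max => xab; rewrite fab ?gab ?mulr0 ?addr0//.
  by move=> /andP[ax xb]; apply: xab; rewrite ax xb !orbT.
by move=> /andP[ax xb]; apply: xab; rewrite ax xb.
Qed.

Lemma test_function0 : test_function (fun _ : R => 0).
Proof.
split; first exact: smooth_cst.
by exists (1 / 2), (1 / 2); split => //; lra.
Qed.

Lemma test_function_sum (I : Type) (r : seq I) (P : pred I) (c : I -> R) (F : I -> R -> R) :
  (forall i, P i -> test_function (F i)) ->
  test_function (fun x => \sum_(i <- r | P i) c i * F i x).
Proof.
move=> tF; elim: r => [|i r IH].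
  by under eq_fun do rewrite big_nil; exact: test_function0.
under eq_fun do rewrite big_cons; case: (boolP (P i)) => [Pi|_ //].
by under eq_fun do rewrite addrC; apply: test_functionD => //; exact: tF.
Qed.

Lemma test_function_derive1n n phi : test_function phi ->
  test_function (derive1n n phi).
Proof.
move=> [sp [a [b [a0 ab b1 pab]]]]; split; first exact: smooth_derive1n.
by exists a, b; split => //; exact: derive1n_supported_in.
Qed.

Lemma test_function_bounded phi : test_function phi ->
  exists K, forall x, `|phi x| <= K.
Proof.
move=> [sp [a [b [a0 ab b1 pab]]]].
exact: supported_in_bounded ab (smooth_continuous sp) pab.
Qed.

Lemma test_function_bounded_derivatives n phi : test_function phi ->
  exists K, forall r x, (r <= n)%N -> `|derive1n r phi x| <= K.
Proof.
move=> tp; elim: n => [|n [K HK]].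
  have [K HK] := test_function_bounded tp.
  by exists K => -[|//] x _; exact: HK.
have [K' HK'] := test_function_bounded (test_function_derive1n n.+1 tp).
exists (Num.max K K') => r x; rewrite leq_eqVlt => /orP[/eqP ->|rn].
  by rewrite le_max HK' orbT.
by rewrite le_max HK.
Qed.

Variable u : (R -> R) -> R.
Hypothesis du : distribution01 u.

Lemma distribution_zero : u (fun=> 0) = 0.
Proof.
have := du.1 _ _ (-1) test_function0 test_function0.
by under eq_fun do rewrite mulr0 addr0; lra.
Qed.

Lemma distribution_sum (I : Type) (r : seq I) (P : pred I) (c : I -> R) (F : I -> R -> R) :
  (forall i, P i -> test_function (F i)) ->
  u (fun x => \sum_(i <- r | P i) c i * F i x) = \sum_(i <- r | P i) c i * u (F i).
Proof.
move=> tF; elim: r => [|i r IH].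
  by under eq_fun do rewrite big_nil; rewrite big_nil distribution_zero.
under eq_fun do rewrite big_cons; rewrite big_cons; case: (boolP (P i)) => [Pi|_ //].
under eq_fun do rewrite addrC.
rewrite du.1 ?IH 1?addrC//; [exact: test_function_sum|exact: tF].
Qed.

Lemma supnorm_deriv_le j phi (K : R) :
  (forall x, `|derive1n j phi x| <= K) -> supnorm_deriv j phi <= K.
Proof.
move=> HK; apply: ge_sup; last by move=> _ [x _ <-]; exact: HK.
by exists (`|derive1n j phi 0|), 0.
Qed.

End TestFunctions.

(** * Quasi-interpolation by differences of a smooth step *)

Section QuasiInterpolation.
Variable R : realType.
Variable N : nat.
Hypothesis N0 : (0 < N)%N.
Implicit Types (f g k phi Psi : R -> R) (a b y : R).

Let d : R := N%:R^-1.
Definition node (i : nat) : R := i%:R / N%:R.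

(* The Riemann-Stieltjes sum of [f] against [x |-> k (x - y)]. *)
Definition RSsum f k y : R :=
  \sum_(i < N) f (node i) * (k (node i.+1 - y) - k (node i - y)).

Let d0 : 0 < d. Proof. by rewrite invr_gt0 ltr0n. Qed.
Let NdE : N%:R * d = 1. Proof. by rewrite divff// pnatr_eq0 -lt0n. Qed.
Let nodeS i : node i.+1 = node i + d.
Proof. by rewrite /node -natr1 mulrDl mul1r. Qed.
Let node0 : node 0 = 0. Proof. by rewrite /node mul0r. Qed.
Let nodeN : node N = 1. Proof. exact: NdE. Qed.

Let weight_affine k i y : k (node i.+1 - y) - k (node i - y) =
  k (-1 * y + node i.+1) + -1 * k (-1 * y + node i).
Proof. by rewrite !mulN1r ![- y + _]addrC. Qed.

Let smooth_weight k i : smooth_on setT k ->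
  smooth_on setT (fun y => k (node i.+1 - y) - k (node i - y)).
Proof.
move=> sk; under eq_fun do rewrite weight_affine.
by apply: smooth_add; [|apply: smooth_scale]; exact: smooth_affine.
Qed.

Lemma smooth_RSsum f k : smooth_on setT k -> smooth_on setT (RSsum f k).
Proof.
by move=> sk; apply: smooth_sum => i; apply: smooth_scale; exact: smooth_weight.
Qed.

Lemma derive1n_RSsum f k j y : smooth_on setT k ->
  derive1n j (RSsum f k) y = (-1) ^+ j * RSsum f (derive1n j k) y.
Proof.
move=> sk; rewrite /RSsum derive1n_sum; last first.
  by move=> i; apply: smooth_scale; exact: smooth_weight.
rewrite mulr_sumr; apply: eq_bigr => i _.
rewrite derive1n_scale; last exact: smooth_weight.
under eq_fun do rewrite weight_affine.
rewrite derive1n_add; [|exact: smooth_affine|by apply: smooth_scale; exact: smooth_affine].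
rewrite derive1n_scale; last exact: smooth_affine.
by rewrite !derive1n_affine// weight_affine; ring.
Qed.

Let sum_by_parts (f g : nat -> R) n :
  \sum_(i < n) f i * (g i.+1 - g i) =
  f n * g n - f 0%N * g 0%N - \sum_(i < n) (f i.+1 - f i) * g i.+1.
Proof.
elim: n => [|n IH]; first by rewrite !big_ord0; ring.
by rewrite !big_ord_recr /= IH; ring.
Qed.

(** Summation by parts moves the difference from [k] to [f], without boundary terms since [f]
    vanishes at 0 and 1. Both sums are then close to the same Riemann sum of f' k'; each of the [N]
    summands costs two Taylor errors of order d^2, and [N * d = 1]. *)
Lemma RSsum_derive f k (F K y : R) :
  smooth_on setT f -> smooth_on setT k -> f 0 = 0 -> f 1 = 0 ->
  (forall r x, (0 < r <= 2)%N -> `|derive1n r f x| <= F) ->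
  (forall r x, (0 < r <= 2)%N -> `|derive1n r k x| <= K) ->
  `|- RSsum f (derive1 k) y - RSsum (derive1 f) k y| <= d * (2 * F * K).
Proof.
move=> sf sk f0 f1 HF HK.
have F0 : 0 <= F by apply: le_trans (HF 1%N 0 isT).
have K0 : 0 <= K by apply: le_trans (HK 1%N 0 isT).
rewrite /RSsum (sum_by_parts (fun i => f (node i)) (fun i => derive1 k (node i - y))).
rewrite node0 nodeN f0 f1 !mul0r subrr sub0r opprK -sumrB.
apply: le_trans (ler_norm_sum _ _ _) _.
have -> : d * (2 * F * K) = \sum_(i < N) d ^+ 2 * (2 * F * K).
  by rewrite sumr_const card_ord -[RHS]mulr_natl expr2 !mulrA NdE mul1r.
apply: ler_sum => i _.
have Ef : `|f (node i.+1) - f (node i) - derive1 f (node i) * d| <= F * d ^+ 2.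
  have := @is_derive_taylor2 R f (derive1n 1 f) (derive1n 2 f) (node i) (node i.+1) F.
  rewrite nodeS [node i + d - node i]addrAC subrr add0r (gtr0_norm d0); apply.
  - by move=> x; exact: (smooth_is_derive 0).
  - by move=> x; exact: (smooth_is_derive 1).
  - by move=> x; exact: HF.
have Ek : `|k (node i - y) - k (node i.+1 - y) - derive1 k (node i.+1 - y) * - d|
    <= K * d ^+ 2.
  have := @is_derive_taylor2 R k (derive1n 1 k) (derive1n 2 k) (node i.+1 - y) (node i - y) K.
  have -> : node i - y - (node i.+1 - y) = - d by rewrite nodeS; ring.
  rewrite normrN (gtr0_norm d0); apply.
  - by move=> x; exact: (smooth_is_derive 0).
  - by move=> x; exact: (smooth_is_derive 1).
  - by move=> x; exact: HK.
set Df := f (node i.+1) - f (node i) in Ef *.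
set k' := derive1 k (node i.+1 - y) in Ek *.
set f' := derive1 f (node i) in Ef *.
have -> : Df * k' - f' * (k (node i.+1 - y) - k (node i - y)) =
   (Df - f' * d) * k' + f' * (k (node i - y) - k (node i.+1 - y) - k' * - d) by ring.
apply: le_trans (ler_normD _ _) _; rewrite !normrM.
have -> : d ^+ 2 * (2 * F * K) = (F * d ^+ 2) * K + F * (K * d ^+ 2) by ring.
by apply: lerD; apply: ler_pM => //; [exact: (HK 1%N)|exact: (HF 1%N)].
Qed.

(** The previous lemma is iterated, at the price of one mesh size per derivative moved. As [K]
    bounds the large derivatives of the step, the product [d * K] is what has to be small. *)
Lemma RSsum_derive1n j f k (F K y : R) :
  smooth_on setT f -> smooth_on setT k ->
  (forall r, derive1n r f 0 = 0) -> (forall r, derive1n r f 1 = 0) ->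
  (forall r x, (0 < r <= j.+1)%N -> `|derive1n r f x| <= F) ->
  (forall r x, (0 < r <= j.+1)%N -> `|derive1n r k x| <= K) ->
  `|(-1) ^+ j * RSsum f (derive1n j k) y - RSsum (derive1n j f) k y|
    <= j%:R * (d * (2 * F * K)).
Proof.
elim: j f => [|j IH] f sf sk f0 f1 HF HK.
  by rewrite expr0 mul1r subrr normr0 mul0r.
have E1 : `|- RSsum f (derive1 (derive1n j k)) y - RSsum (derive1 f) (derive1n j k) y|
    <= d * (2 * F * K).
  apply: RSsum_derive => //; [exact: smooth_derive1n|exact: (f0 0%N)|exact: (f1 0%N)| |].
    move=> r x /andP[r0 r2]; apply: HF; rewrite r0/=.
    exact: leq_trans r2 _.
  move=> r x /andP[r0 r2]; rewrite /derive1n -iterD; apply: HK.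
  by rewrite addn_gt0 r0/= -(addn2 j) addnC leq_add2l.
have Hs r x : derive1n r (derive1 f) x = derive1n r.+1 f x by rewrite derive1nSr.
have E2 : `|(-1) ^+ j * RSsum (derive1 f) (derive1n j k) y
             - RSsum (derive1n j (derive1 f)) k y| <= j%:R * (d * (2 * F * K)).
  apply: IH => [||r|r|r x /andP[r0 rj]|r x /andP[r0 rj]]; rewrite ?Hs//.
  - exact: (@smooth_derive1n _ f 1).
  - by apply: HF; rewrite /= ltnS.
  - by apply: HK; rewrite r0/= (leq_trans rj).
rewrite -(derive1nSr j) in E2.
have -> : (-1) ^+ j.+1 * RSsum f (derive1n j.+1 k) y - RSsum (derive1n j.+1 f) k y =
  (-1) ^+ j * (- RSsum f (derive1 (derive1n j k)) y - RSsum (derive1 f) (derive1n j k) y)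
  + ((-1) ^+ j * RSsum (derive1 f) (derive1n j k) y - RSsum (derive1n j.+1 f) k y).
  by rewrite exprS [derive1n j.+1 k]derive1nS; ring.
apply: le_trans (ler_normD _ _) _.
rewrite normrM normrX normrN1 expr1n mul1r -natr1 mulrDl mul1r addrC.
exact: lerD.
Qed.

(** The sum is a weighted mean: the weights are nonnegative, add up to 1 wherever [g y] can be
    nonzero, and vanish for nodes farther than [w + d] from [y]. *)
Lemma RSsum_step w Psi g (L y : R) : step_function w Psi ->
  smooth_on setT g -> (forall x, `|derive1 g x| <= L) -> supported_in w (1 - w) g ->
  `|RSsum g Psi y - g y| <= L * (w + d).
Proof.
move=> [sP P0 P1 Pm _] sg gL gw.
have L0 : 0 <= L by apply: le_trans (gL 0).
pose th i := Psi (node i.+1 - y) - Psi (node i - y).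
have th0 i : 0 <= th i by rewrite subr_ge0 Pm// lerB// nodeS lerDl ltW.
have sth : \sum_(i < N) th i = Psi (1 - y) - Psi (- y).
  have := @telescope_sumr R 0 N (fun i => Psi (node i - y)) (leq0n _).
  by rewrite big_mkord nodeN node0 sub0r.
have P01 x : 0 <= Psi x <= 1.
  apply/andP; split.
    have [/P0 ->//|/ltW] := leP x (- w).
    by move=> /Pm; rewrite (P0 (- w)).
  have [/P1 ->//|/ltW] := leP w x.
  by move=> /Pm; rewrite (P1 w).
have gs : g y * (\sum_(i < N) th i) = g y.
  have [yw|yw] := pselect (w <= y <= 1 - w); last by rewrite gw// mul0r.
  by move/andP : yw => [? ?]; rewrite sth P1 ?P0; lra.
have -> : RSsum g Psi y - g y = \sum_(i < N) (g (node i) - g y) * th i.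
  rewrite -[in LHS]gs mulr_sumr /RSsum -sumrB.
  by apply: eq_bigr => i _; rewrite mulrBl.
apply: le_trans (ler_norm_sum _ _ _) _.
apply: (@le_trans _ _ (\sum_(i < N) L * (w + d) * th i)); last first.
  (* For a negative [w] the value [Psi 0] would be both 0 and 1. *)
  have w0 : 0 <= w.
    rewrite leNgt; apply/negP => w0.
    have := P0 0; have := P1 0; rewrite oppr_ge0 (ltW w0) => -> // /(_ isT).
    by move/eqP; rewrite oner_eq0.
  rewrite -mulr_sumr ler_piMr// ?mulr_ge0// ?addr_ge0//; first exact: ltW.
  rewrite sth; have /andP[] := P01 (1 - y); have /andP[] := P01 (- y); lra.
apply: ler_sum => i _; rewrite normrM (ger0_norm (th0 i)).
have [near|far] := leP (`|node i - y|) (w + d).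
  apply: ler_wpM2r => //; rewrite distrC.
  have := @is_derive_lip R g (derive1 g) (node i) y L.
  move=> /(_ (fun x _ => conj (smooth_is_derive 0 x sg) (gL x))) /le_trans; apply.
  by rewrite ler_wpM2l// distrC.
suff -> : th i = 0 by rewrite !mulr0.
have dd := d0; rewrite /th nodeS; move: far; rewrite ltr_normr => /orP[far|far].
  by rewrite !P1 ?subrr//; lra.
by rewrite !P0 ?subrr//; lra.
Qed.

End QuasiInterpolation.

(** * Approximation by finite combinations of Dirac masses *)

Section DiscreteApproximation.
Variable R : realType.

(* The mesh size beats [n + 1] derivatives of the step: since [n] grows, this
   copes with any order of the distribution, uniformly in the test function. *)
Let exists_mesh (n : nat) : exists (NP : nat * (R -> R)), [/\ (0 < NP.1)%N,
  step_function n.+1%:R^-1 NP.2, NP.1%:R^-1 <= n.+1%:R^-1 :> R &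
  exists2 W, (forall r x, (r <= n.+1)%N -> `|derive1n r NP.2 x| <= W) &
    0 <= W /\ NP.1%:R^-1 * W <= n.+1%:R^-1].
Proof.
have n0 : 0 < n.+1%:R^-1 :> R by rewrite invr_gt0.
have [Psi sPsi] := exists_step n0.
have [W HW] : exists W, forall r x, (r <= n.+1)%N -> `|derive1n r Psi x| <= W.
  have [_ _ _ _ Pb] := sPsi.
  elim: n.+1 => [|m [W HW]].
    by have [W HW] := Pb 0%N; exists W => -[|//] x _; exact: HW.
  have [W' HW'] := Pb m.+1.
  exists (Num.max W W') => r x; rewrite leq_eqVlt => /orP[/eqP ->|rn].
    by rewrite le_max HW' orbT.
  by rewrite le_max HW.
have W0 : 0 <= W by apply: le_trans (HW 0%N 0 isT).
(* An integer above [W]: the mesh 1/((n+1) M) then satisfies both required inequalities. *)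
pose M := (Num.truncn W).+1.
have WM : W <= M%:R by apply: ltW; exact: truncnS_gt.
exists ((n.+1 * M)%N, Psi) => /=; split => //.
  by rewrite lef_pV2 ?posrE ?ltr0n// ler_nat leq_pmulr.
exists W => //; split => //.
by rewrite natrM invfM -mulrA ler_piMr ?(ltW n0)// ler_pdivrMl ?ltr0n// mulr1.
Qed.

(** The coefficients are the values of [u] on the weight functions. By linearity the discrete sum is
    then [u] of the quasi-interpolant of [phi], and continuity of [u] on one compact set reduces the
    claim to convergence of finitely many derivatives. *)
Theorem distribution_discrete_approximation (u : (R -> R) -> R) :
  distribution01 u ->
  exists (N : nat -> nat) (c : nat -> nat -> R),
    (forall n i, c n i != 0 -> 0 < node R (N n) i < 1) /\
    forall phi, test_function phi ->
      (fun n => \sum_(i < N n) c n i * phi (node R (N n) i)) @ \oo --> u phi.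
Proof.
move=> du; have [NP HNP] := choice exists_mesh.
pose N n := (NP n).1; pose Psi n := (NP n).2.
pose x n i := node R (N n) i; pose w n : R := n.+1%:R^-1; pose d n : R := (N n)%:R^-1.
pose th n i y := Psi n (x n i.+1 - y) - Psi n (x n i - y).
(* Keeps the nodes whose weight function is supported inside (0,1), so that [u] may be evaluated on
   it. For large [n] the rejected nodes lie outside the support of [phi]. *)
pose G n i := (w n < x n i) && (x n i + d n + w n < 1).
exists N, (fun n i => if G n i then u (th n i) else 0).
have N0 n : (0 < N n)%N by have [] := HNP n.
have w0 n : 0 < w n by rewrite invr_gt0.
have d0 n : 0 < d n by rewrite invr_gt0 ltr0n.
have xS n i : x n i.+1 = x n i + d n by rewrite /x /node -natr1 mulrDl mul1r.
have thz n i y : ~ (x n i - w n <= y <= x n i + d n + w n) -> th n i y = 0.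
  move=> xy; have [_ [_ P0 P1 _ _] _ _] := HNP n; rewrite /th xS.
  have [h|h] := ltP y (x n i - w n).
    by have dn := d0 n; rewrite /Psi !P1 ?subrr//; rewrite -/(w n); lra.
  have [h'|h'] := ltP (x n i + d n + w n) y; last by case: xy; rewrite h.
  by have dn := d0 n; rewrite /Psi !P0 ?subrr//; rewrite -/(w n); lra.
have sth n i : smooth_on setT (th n i).
  have [_ [sP _ _ _ _] _ _] := HNP n.
  have -> : th n i = fun y => Psi n (-1 * y + x n i.+1) + -1 * Psi n (-1 * y + x n i).
    by apply/funext => y; rewrite /th !mulN1r ![- y + _]addrC.
  by apply: smooth_add; [|apply: smooth_scale]; exact: smooth_affine.
have tth n i : G n i -> test_function (th n i).
  move=> /andP[G1 G2]; split => //.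
  have wn := w0 n; have dn := d0 n.
  exists (x n i - w n), (x n i + d n + w n); split; [lra|lra|lra|exact: thz].
split=> [n i|phi tphi].
  case: ifPn => [/andP[G1 G2] _|]; last by rewrite eqxx.
  by have wn := w0 n; have dn := d0 n; rewrite -/(x n i); apply/andP; split; lra.
have [sphi [a [b [a0 ab b1 pab]]]] := tphi.
(* A compact set slightly larger than the support of [phi], fixed before [n], so that the order [k]
   does not depend on [n]. *)
have [|||C [k HC]] := du.2 (a / 2) ((b + 1) / 2); [lra|lra|lra|].
have [A HA] := test_function_bounded_derivatives k.+1 tphi.
have A0 : 0 <= A by apply: le_trans (HA 0%N 0 isT).
have phiz r z : ~ (a <= z <= b) -> derive1n r phi z = 0.
  exact: derive1n_supported_in.
(* The first condition puts the [k + 1] derivatives of the step under the control of the mesh. Since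
   [d n <= w n], the other two keep the quasi-interpolant supported in the compact set chosen
   above. *)
have main n : (k <= n)%N -> 2 * w n < a / 2 -> 2 * w n < (1 - b) / 2 ->
  `|\sum_(i < N n) (if G n i then u (th n i) else 0) * phi (x n i) - u phi|
   <= `|C| * (k.+1%:R * (A * (2 * k.+1%:R))) * w n.
  move=> kn wa wb; have wn := w0 n; have dn := d0 n.
  have [_ stepn dw [W HW [W0 dWw]]] := HNP n.
  pose h := RSsum (N n) phi (Psi n).
  have phz i : ~~ G n i -> phi (x n i) = 0.
    move=> nG; apply: pab => /andP[ax xb]; move: nG; rewrite negb_and -!leNgt.
    by move: dw; rewrite -/(d n) -/(w n) => dw /orP[]; lra.
  have hE : h = fun y => \sum_(i < N n | G n i) phi (x n i) * th n i y.
    apply/funext => y; rewrite /h /RSsum [RHS]big_mkcond /=; apply: eq_bigr => i _.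
    by case: ifPn => // /phz; rewrite /x => ->; rewrite mul0r.
  have th' : test_function h.
    by rewrite hE; apply: (test_function_sum _ (P := fun i : 'I_(N n) => G n i)) => i; exact: tth.
  have uh : \sum_(i < N n) (if G n i then u (th n i) else 0) * phi (x n i) = u h.
    rewrite hE (distribution_sum du _ _ (P := fun i : 'I_(N n) => G n i)); last by move=> i; exact: tth.
    rewrite [RHS]big_mkcond /=; apply: eq_bigr => i _.
    by case: ifPn; rewrite ?mul0r// mulrC.
  have -> : \sum_(i < N n) (if G n i then u (th n i) else 0) * phi (x n i) - u phi
      = u (fun y => h y + -1 * phi y) by rewrite uh du.1//; ring.
  have hp : supported_in (a / 2) ((b + 1) / 2) (fun y => h y + -1 * phi y).
    move=> y hy; rewrite (pab y) ?mulr0 ?addr0; last first.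
      by move=> /andP[ay yb]; apply: hy; apply/andP; split; lra.
    rewrite hE big1// => i _; have [px|] := eqVneq (phi (x n i)) 0.
      by rewrite px mul0r.
    move=> px; rewrite thz ?mulr0// => /andP[h1 h2]; apply: hy.
    have [/andP[h3 h4]|nab] := pselect (a <= x n i <= b); last by rewrite pab ?eqxx in px.
    by move: dw; rewrite -/(d n) -/(w n) => dw; apply/andP; split; lra.
  apply: le_trans (HC _ (test_functionD _ th' tphi) hp) _.
  have S0 : 0 <= \sum_(j < k.+1) A * (2 * k.+1%:R) * w n.
    by apply: sumr_ge0 => i _; rewrite !mulr_ge0// ltW.
  apply: (@le_trans _ _ (`|C| * \sum_(j < k.+1) A * (2 * k.+1%:R) * w n)); last first.
    by rewrite sumr_const card_ord -[X in _ * X <= _]mulr_natl !mulrA.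
  apply: (@le_trans _ _ (`|C| * \sum_(j < k.+1) supnorm_deriv j (fun y => h y + -1 * phi y))).
    apply: ler_wpM2r; last exact: ler_norm.
    apply: sumr_ge0 => j _; apply: le_trans (normr_ge0 (derive1n j (fun y => h y + -1 * phi y) 0)) _.
    have [K HK] := test_function_bounded (test_function_derive1n j (test_functionD (-1) th' tphi)).
    by apply: ub_le_sup; [exists K => _ [y _ <-]; exact: HK|exists 0].
  apply: ler_wpM2l => //; apply: ler_sum => j _; apply: supnorm_deriv_le => y.
  have jk : (j <= k)%N by rewrite -ltnS.
  have [sP _ _ _ _] := stepn.
  rewrite derive1n_add//; [|exact: smooth_RSsum|exact: smooth_scale].
  rewrite derive1n_scale// derive1n_RSsum// mulN1r.
  have -> : (-1) ^+ j * RSsum (N n) phi (derive1n j (Psi n)) y - derive1n j phi y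
    = ((-1) ^+ j * RSsum (N n) phi (derive1n j (Psi n)) y - RSsum (N n) (derive1n j phi) (Psi n) y)
      + (RSsum (N n) (derive1n j phi) (Psi n) y - derive1n j phi y) by ring.
  apply: le_trans (ler_normD _ _) _.
  have E1 := @RSsum_derive1n R (N n) (N0 n) j phi (Psi n) A W y sphi sP.
  have E2 := @RSsum_step R (N n) (N0 n) (w n) (Psi n) (derive1n j phi) A y stepn.
  apply: (@le_trans _ _ (j%:R * (d n * (2 * A * W)) + A * (w n + d n))).
    apply: lerD; [apply: E1|apply: E2].
    - by move=> r; apply: phiz => /andP[? ?]; lra.
    - by move=> r; apply: phiz => /andP[? ?]; lra.
    - by move=> r z /andP[_ rj]; apply: HA; exact: leq_trans rj _.
    - by move=> r z /andP[_ rj]; apply: HW; rewrite (leq_trans rj)// ltnS (leq_trans jk).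
    - exact: smooth_derive1n.
    - by move=> z; rewrite -derive1nS; apply: HA.
    - move=> z zw; apply: phiz => /andP[za zb].
      by apply: zw; apply/andP; split; lra.
  (* The first term bounds the cost of moving derivatives, through [d n * W <= w n]; the second
     bounds the averaging error, through [d n <= w n]. *)
  have -> : A * (2 * k.+1%:R) * w n = k%:R * (w n * (2 * A)) + A * (w n + w n).
    by rewrite -natr1; ring.
  apply: lerD; last by rewrite ler_wpM2l// lerD2l.
  apply: ler_pM; rewrite ?ler_nat//; first by rewrite !mulr_ge0// (ltW dn).
  by rewrite [2 * A * W]mulrC mulrA ler_wpM2r// mulr_ge0.
have wlim : w n @[n --> \oo] --> (0 : R) by exact: cvg_harmonic.
have Blim : `|C| * (k.+1%:R * (A * (2 * k.+1%:R))) * w n @[n --> \oo] --> (0 : R).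
  by rewrite -[X in _ --> X](mulr0 (`|C| * (k.+1%:R * (A * (2 * k.+1%:R))))); exact: cvgZr.
apply/cvgrPdist_le => e e0; near=> n.
rewrite distrC; apply: le_trans (main n _ _ _) _.
- by near: n; exact: nbhs_infty_ge.
- rewrite -ltr_pdivlMl//.
  near: n; apply: (cvgr_lt _ wlim); rewrite mulr_gt0// ?divr_gt0//; lra.
- rewrite -ltr_pdivlMl//.
  near: n; apply: (cvgr_lt _ wlim); rewrite mulr_gt0// ?divr_gt0//; lra.
by near: n; exact: (cvgr_le _ Blim).
Unshelve. all: by end_near. Qed.

End DiscreteApproximation.

Section UnitIntegral.
Variable R : realType.
Implicit Types (f g : R -> R).
Notation mu := (@lebesgue_measure R).

Lemma measurable_I01 : measurable (@I01 R).
Proof. exact: measurable_itv. Qed.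

Lemma integrable_I01 f : continuous f -> mu.-integrable (@I01 R) (EFin \o f).
Proof.
move=> cf; apply: (integrableS _ _ _ (continuous_integrable_itv 0 1 cf)).
- exact: measurable_itv.
- exact: measurable_I01.
- exact: subset_itv_oo_cc.
Qed.

Definition int01 f : R := \int[mu]_(x in @I01 R) f x.

Lemma int01D f g : continuous f -> continuous g ->
  int01 (fun x => f x + g x) = int01 f + int01 g.
Proof.
by move=> cf cg; rewrite /int01 RintegralD//; [exact: measurable_I01|exact: integrable_I01..].
Qed.

Lemma int01Z (c : R) f : continuous f -> int01 (fun x => c * f x) = c * int01 f.
Proof.
by move=> cf; rewrite /int01 RintegralZl//; [exact: measurable_I01|exact: integrable_I01].
Qed.

Lemma int01_cst (c : R) : int01 (fun=> c) = c.
Proof.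
rewrite /int01 Rintegral_cst; last exact: measurable_I01.
have E : mu (@I01 R) = 1%:E.
  rewrite /I01; have := @lebesgue_measure_itv R `]0, 1[.
  by rewrite /= lte_fin ltr01 oppr0 adde0.
by rewrite -[RHS]mulr1; congr (_ * _); exact: (congr1 fine E).
Qed.

Lemma continuous_bigsum (I : Type) (r : seq I) (F : I -> R -> R) :
  (forall i, continuous (F i)) -> continuous (fun x => \sum_(i <- r) F i x).
Proof.
move=> cF; elim: r => [|i r IH].
  by under eq_fun do rewrite big_nil; move=> x; exact: cvg_cst.
under eq_fun do rewrite big_cons.
by move=> x; apply: cvgD; [exact: cF|exact: IH].
Qed.

Lemma int01_sum (I : Type) (r : seq I) (c : I -> R) (F : I -> R -> R) :
  (forall i, continuous (F i)) ->
  int01 (fun x => \sum_(i <- r) c i * F i x) = \sum_(i <- r) c i * int01 (F i).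
Proof.
move=> cF; have cc i : continuous (fun x => c i * F i x).
  by move=> x; apply: cvgM; [exact: cvg_cst|exact: cF].
elim: r => [|i r IH].
  by under [X in int01 X]eq_fun do rewrite big_nil; rewrite big_nil int01_cst.
under [X in int01 X]eq_fun do rewrite big_cons.
rewrite big_cons int01D ?int01Z ?IH//.
exact: continuous_bigsum.
Qed.

Lemma le_int01 f g : continuous f -> continuous g ->
  (forall x, 0 < x < 1 -> f x <= g x) -> int01 f <= int01 g.
Proof.
move=> cf cg fg; apply: le_Rintegral; [exact: measurable_I01|exact: integrable_I01..|].
by move=> x; rewrite /I01/= in_itv/=; exact: fg.
Qed.

Lemma le_norm_int01 f : continuous f -> `|int01 f| <= int01 (fun x => `|f x|).
Proof.
by move=> cf; apply: le_normr_Rintegral; [exact: measurable_I01|exact: integrable_I01].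
Qed.

Lemma int01_ge_itv f (a b c : R) : continuous f -> (forall x, 0 <= f x) ->
  0 <= a -> a < b -> b <= 1 -> 0 <= c -> (forall x, a < x < b -> c <= f x) ->
  c * (b - a) <= int01 f.
Proof.
move=> cf f0 a0 ab b1 c0 cf'.
rewrite -lee_fin /int01 /Rintegral fineK; last first.
  by apply: integrable_fin_num; [exact: measurable_I01|exact: integrable_I01].
apply: (@le_trans _ _ (\int[mu]_(x in `]a, b[) (f x)%:E)%E); last first.
  apply: ge0_subset_integral => //.
  - exact: measurable_I01.
  - by apply: (measurable_int mu); exact: integrable_I01.
  - by move=> x _; rewrite lee_fin.
  - move=> x; rewrite /I01/= !in_itv/= => /andP[ax xb].
    by rewrite (le_lt_trans a0 ax) (lt_le_trans xb b1).
apply: (@le_trans _ _ (\int[mu]_(x in `]a, b[) (cst c%:E x))%E).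
  have E : mu `]a, b[ = (b - a)%:E.
    by have := @lebesgue_measure_itv R `]a, b[; rewrite /= lte_fin ab -EFinB.
  rewrite EFinM integral_cst//.
  exact: (eq_ind_r (fun z => c%:E * (b - a)%:E <= c%:E * z)%E (lexx _) E).
apply: ge0_le_integral => //=.
apply: (measurable_int mu); apply: integrableS (continuous_integrable_itv a b cf) => //.
exact: subset_itv_oo_cc.
Qed.

End UnitIntegral.

(** * Landau kernels in the variable cos (pi x) *)

Section LandauKernel.
Variable R : realType.

Lemma continuous_cospi : continuous (fun x : R => cos (pi * x)).
Proof.
move=> x; apply: continuous_comp; last exact: continuous_cos.
by apply: cvgM; [exact: cvg_cst|exact: cvg_id].
Qed.

Lemma continuous_horner_cospi (p : {poly R}) : continuous (fun x : R => p.[cos (pi * x)]).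
Proof.
move=> x; apply: (@continuous_comp _ _ _ (fun x => cos (pi * x)) (horner p)).
  exact: continuous_cospi.
exact: continuous_horner.
Qed.

Lemma cospi_lip (x y : R) : `|cos (pi * x) - cos (pi * y)| <= 4 * `|x - y|.
Proof.
apply: (@is_derive_lip R (fun x => cos (pi * x)) (fun x => pi * - sin (pi * x))) => z _.
split.
  have := @is_derive_affine R (@cos R) z _ pi 0 (is_derive_cos _).
  by rewrite addr0; under eq_fun do rewrite addr0.
rewrite normrM normrN (gtr0_norm (pi_gt0 R)) -[leRHS]mulr1.
apply: ler_pM => //; [exact: pi_ge0| |exact: sin_max].
by have := pihalf_lt2 R; lra.
Qed.

Lemma cospi_lt (x y : R) : 0 <= x -> x < y -> y <= 1 -> cos (pi * y) < cos (pi * x).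
Proof.
move=> x0 xy y1; have p0 := pi_gt0 R.
have h t : 0 <= t <= 1 -> pi * t \in `[0, (pi : R)].
  by move=> /andP[t0 t1]; rewrite in_itv/= mulr_ge0 ?(ltW p0)//= ler_piMr// ltW.
by rewrite ltr_cos ?ltr_pM2l//; apply: h; apply/andP; split; lra.
Qed.

(** The kernel is a normalised high power of 1 - (cos (pi x) - cos (pi y))^2 / 4, which on (0,1)
    attains its maximum only at [y] because cos (pi x) is strictly decreasing. The error is stated
    through the Lipschitz constant so that a single kernel serves all functions [f]. *)
Lemma cospi_kernel (y e : R) : 0 < y < 1 -> 0 < e ->
  exists r : {poly R}, forall (f : R -> R) (L : R), continuous f ->
    (forall x, 0 < x < 1 -> `|f x - f y| <= L * `|x - y|) ->
    `|int01 (fun x => r.[cos (pi * x)] * f x) - f y| <= e * L.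
Proof.
move=> /andP[y0 y1] e0.
set c := cos (pi * y).
pose del := Num.min (e / 2) (Num.min y (1 - y)).
have del0 : 0 < del by rewrite !lt_min divr_gt0// y0 subr_gt0.
have [dele dely dely1] : [/\ del <= e / 2, del <= y & del <= 1 - y].
  by rewrite /del; split; rewrite !ge_min lexx ?orbT.
pose m1 := c - cos (pi * (y + del)); pose m2 := cos (pi * (y - del)) - c.
have m10 : 0 < m1 by rewrite subr_gt0 cospi_lt//; lra.
have m20 : 0 < m2 by rewrite subr_gt0 cospi_lt//; lra.
pose mm := Num.min m1 m2.
have mm0 : 0 < mm by rewrite lt_min m10.
have c1 := cos_le1 (pi * y); have c2 := cos_geN1 (pi * y).
have mm2 : mm <= 2.
  rewrite ge_min; apply/orP; left.
  by rewrite /m1; have := cos_geN1 (pi * (y + del)); rewrite -/c in c1 *; lra.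
pose m := mm ^+ 2 / 4.
have m0 : 0 < m by rewrite divr_gt0// exprn_gt0.
have m1' : m <= 1 by rewrite /m; nra.
(* Two cosines differ by at most 2, so the division by 4 keeps [g] between 0 and 1. *)
pose g x : R := 1 - (cos (pi * x) - c) ^+ 2 / 4.
have g0 x : 0 <= g x.
  rewrite /g; have := cos_le1 (pi * x); have := cos_geN1 (pi * x).
  by rewrite -/c in c1 c2; nra.
have gfar x : 0 < x < 1 -> del < `|x - y| -> g x <= 1 - m.
  move=> /andP[x0 x1] far; rewrite lerD2l lerN2 ler_pM2r; last by lra.
  have [h1 h2] : mm <= m1 /\ mm <= m2 by split; rewrite ge_min lexx ?orbT.
  have : mm <= `|cos (pi * x) - c|.
    rewrite ler_normr; move: far; rewrite ltr_normr => /orP[far|far]; apply/orP.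
      right; apply: le_trans h1 _; rewrite /m1 opprB lerB// ltW// cospi_lt//; lra.
    left; apply: le_trans h2 _; rewrite /m2 lerB// ltW// cospi_lt//; lra.
  by rewrite -[X in _ -> _ <= X]real_normK ?num_real// => h; rewrite lerXn2r// nnegrE// ltW.
(* Since cos (pi x) is 4-Lipschitz, it stays within [m] of [c] at distance at most [m / 4]; as
   [m <= 1], this gives [g >= 1 - m / 2], above the bound [1 - m] valid far from [y]. *)
pose del' := Num.min (m / 4) del.
have del'0 : 0 < del' by rewrite lt_min del0 divr_gt0.
have [del'm del'd] : del' <= m / 4 /\ del' <= del by split; rewrite ge_min lexx ?orbT.
have gnear x : y - del' < x < y -> 1 - m / 2 <= g x.
  move=> /andP[xl xr]; rewrite lerD2l lerN2.
  have := cospi_lip x y; rewrite -/c => lip.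
  have ny : `|x - y| <= m / 4 by rewrite ler0_norm; lra.
  have h : `|cos (pi * x) - c| <= m by lra.
  rewrite -real_normK ?num_real//.
  by have := normr_ge0 (cos (pi * x) - c); nra.
pose rho := (1 - m) / (1 - m / 2).
have h12 : 0 < 1 - m / 2 by lra.
have rho0 : 0 <= rho by rewrite divr_ge0//; lra.
have rho1 : rho < 1 by rewrite ltr_pdivrMr// mul1r; lra.
(* The total mass [Z] is at least [(1 - m / 2) ^+ M * del'], so this choice makes the far part
   [(1 - m) ^+ M] at most [e / 2 * Z]. *)
have [M HM] : exists M, rho ^+ M <= del' * (e / 2).
  have lim : rho ^+ n @[n --> \oo] --> (0 : R) by apply: cvg_expr; rewrite ger0_norm.
  have pos : 0 < del' * (e / 2) by rewrite mulr_gt0// divr_gt0.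
  have [M _ HM] := cvgr_le _ lim _ pos.
  by exists M; apply: HM => /=.
pose P : {poly R} := (1 - (4^-1)%:P * ('X - c%:P) ^+ 2) ^+ M.
pose k x := P.[cos (pi * x)].
have kE x : k x = g x ^+ M.
  by rewrite /k /P horner_exp hornerD hornerN hornerM horner_exp hornerD hornerN
    !hornerC hornerX /g mulrC.
have ck : continuous k by exact: continuous_horner_cospi.
have k0 x : 0 <= k x by rewrite kE exprn_ge0.
pose Z := int01 k.
have ZE : (1 - m / 2) ^+ M * del' <= Z.
  have -> : del' = y - (y - del') by ring.
  apply: int01_ge_itv => //; try lra; first by rewrite exprn_ge0// ltW.
  by move=> x xy; rewrite kE lerXn2r// ?nnegrE ?gnear// ltW.
have Z0 : 0 < Z by apply: lt_le_trans ZE; rewrite mulr_gt0// exprn_gt0.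
exists (Z^-1 *: P) => f L cf fL.
have L0 : 0 <= L.
  pose z := y / 2; have := fL z; rewrite /z => /(_ _)/(le_trans (normr_ge0 _)).
  have -> : 0 < y / 2 < 1 by apply/andP; split; lra.
  move=> /(_ isT); rewrite pmulr_lge0// normr_gt0 subr_eq0; apply/eqP; lra.
have cfy : continuous (fun x => f x - f y).
  by move=> x; apply: cvgB; [exact: cf|exact: cvg_cst].
have ckf : continuous (fun x => k x * (f x - f y)).
  by move=> x; apply: cvgM; [exact: ck|exact: cfy].
have -> : int01 (fun x => (Z^-1 *: P).[cos (pi * x)] * f x) - f y =
    Z^-1 * int01 (fun x => k x * (f x - f y)).
  have -> : (fun x => (Z^-1 *: P).[cos (pi * x)] * f x) =
      (fun x => Z^-1 * (k x * (f x - f y)) + (Z^-1 * f y) * k x).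
    by apply/funext => x; rewrite hornerZ -/(k x); ring.
  rewrite int01D ?int01Z//; last 2 first.
  - by move=> x; apply: cvgM; [exact: cvg_cst|exact: ckf].
  - by move=> x; apply: cvgM; [exact: cvg_cst|exact: ck].
  by rewrite -/Z; field; rewrite lt0r_neq0.
rewrite normrM normfV (gtr0_norm Z0) ler_pdivrMl//.
apply: le_trans (le_norm_int01 ckf) _.
have cnb : continuous (fun x => `|k x * (f x - f y)|).
  by move=> x; apply: cvg_norm; exact: ckf.
have cmaj : continuous (fun x => L * del * k x + L * (1 - m) ^+ M).
  move=> x; apply: cvgD; last exact: cvg_cst.
  by apply: cvgM; [exact: cvg_cst|exact: ck].
apply: (@le_trans _ _ (int01 (fun x => L * del * k x + L * (1 - m) ^+ M))).
  apply: le_int01 => // x x01; rewrite normrM (ger0_norm (k0 x)).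
  have fx := fL x x01; have kx := k0 x.
  have [near|far] := leP `|x - y| del.
    apply: (@le_trans _ _ (k x * (L * del))).
      by rewrite ler_wpM2l// (le_trans fx)// ler_wpM2l.
    by rewrite mulrC lerDl mulr_ge0// exprn_ge0//; lra.
  apply: (@le_trans _ _ ((1 - m) ^+ M * L)); last first.
    by rewrite [X in X <= _]mulrC lerDr !mulr_ge0// ltW.
  apply: ler_pM => //.
    by rewrite kE lerXn2r// ?nnegrE ?gfar//; lra.
  apply: le_trans fx _; rewrite ler_piMr// ler_norml.
  by move: x01 => /andP[? ?]; apply/andP; split; lra.
rewrite int01D; [|by move=> x; apply: cvgM; [exact: cvg_cst|exact: ck]|by move=> x; exact: cvg_cst].
rewrite int01Z// int01_cst -/Z.
have -> : (1 - m) ^+ M = rho ^+ M * (1 - m / 2) ^+ M.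
  by rewrite -exprMn /rho divfK// lt0r_neq0.
have E1 : L * del * Z <= L * (e / 2) * Z by rewrite ler_pM2r// ler_wpM2l.
have E2 : rho ^+ M * (1 - m / 2) ^+ M <= e / 2 * Z.
  apply: (@le_trans _ _ (del' * (e / 2) * (1 - m / 2) ^+ M)).
    by rewrite ler_pM2r// exprn_gt0.
  have -> : del' * (e / 2) * (1 - m / 2) ^+ M = e / 2 * ((1 - m / 2) ^+ M * del') by ring.
  by rewrite ler_wpM2l// ltW// divr_gt0.
have := ler_wpM2l L0 E2; lra.
Qed.

End LandauKernel.

Section PolynomialApproximation.
Variable R : realType.

(** Each kernel acts on [s * phi] and returns about [s (x_i) * phi (x_i)], so the Dirac coefficient
    is divided by [s (x_i)]. One proof thus covers the potential, with [s] equal to 1, and the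
    initial data, with sin (pi x). *)
Theorem distribution_cospi_approximation (u : (R -> R) -> R) (s ds : R -> R) (S : R) :
  distribution01 u -> (forall x : R, is_derive x 1 s (ds x)) ->
  (forall x, `|s x| <= 1) -> (forall x, `|ds x| <= S) ->
  (forall x, 0 < x < 1 -> 0 < s x) ->
  exists p : nat -> {poly R}, forall phi, test_function phi ->
    (fun n => int01 (fun x => s x * (p n).[cos (pi * x)] * phi x)) @ \oo --> u phi.
Proof.
move=> du sD s1 dsS s0.
have [N [c [c01 cu]]] := distribution_discrete_approximation du.
pose x n i := node R (N n) i.
pose B n := 1 + \sum_(i < N n) `|c n i|.
have B0 n : 0 < B n by rewrite ltr_wpDr// sumr_ge0.
have S0 : 0 <= S by apply: le_trans (dsS 0).
(* Here [s (x n i)] offsets the division in the coefficient, [1 + S] the Lipschitz constant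
   [(1 + S) * A] of [s * phi], and [B n] the sum of the coefficients; what remains is
   [A / (n + 1)]. *)
pose e n i := s (x n i) / ((1 + S) * (B n * n.+1%:R)).
have D0 n : 0 < (1 + S) * (B n * n.+1%:R) by rewrite !mulr_gt0// ltr_wpDr.
have /choice[r Hr] : forall ni : nat * nat, exists r : {poly R}, c ni.1 ni.2 != 0 ->
   forall (f : R -> R) (L : R), continuous f ->
    (forall z, 0 < z < 1 -> `|f z - f (x ni.1 ni.2)| <= L * `|z - x ni.1 ni.2|) ->
    `|int01 (fun z => r.[cos (pi * z)] * f z) - f (x ni.1 ni.2)| <= e ni.1 ni.2 * L.
  move=> [n i] /=; have [_|cn] := eqVneq (c n i) 0; first by exists 0.
  have [|r Hr] := @cospi_kernel R (x n i) (e n i) (c01 _ _ cn).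
    by rewrite divr_gt0// s0// c01.
  by exists r.
exists (fun n => \sum_(i < N n) (c n i / s (x n i)) *: r (n, nat_of_ord i)) => phi tphi.
have [A HA] := test_function_bounded_derivatives 1 tphi.
have A0 : 0 <= A by apply: le_trans (HA 0%N 0 isT).
have [sphi _] := tphi.
have phiD (z : R) : is_derive z 1 phi (derive1 phi z) by exact: (smooth_is_derive 0).
have csphi : continuous (fun z => s z * phi z).
  move=> z; apply: cvgM; first exact: is_derive_continuous (sD z).
  exact: smooth_continuous.
have crs n i : continuous (fun z => (r (n, i)).[cos (pi * z)] * (s z * phi z)).
  move=> z; apply: cvgM; last exact: csphi.
  exact: continuous_horner_cospi.
have main n : `|int01 (fun z => s z * (\sum_(i < N n) (c n i / s (x n i)) *:
      r (n, nat_of_ord i)).[cos (pi * z)] * phi z)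
    - \sum_(i < N n) c n i * phi (x n i)| <= A * n.+1%:R^-1.
  have -> : (fun z => s z * (\sum_(i < N n) (c n i / s (x n i)) *:
      r (n, nat_of_ord i)).[cos (pi * z)] * phi z) =
      (fun z => \sum_(i < N n) c n i / s (x n i) *
         ((r (n, nat_of_ord i)).[cos (pi * z)] * (s z * phi z))).
    apply/funext => z; rewrite horner_sum mulr_sumr mulr_suml.
    by apply: eq_bigr => i _; rewrite hornerZ; ring.
  rewrite int01_sum// -sumrB; apply: le_trans (ler_norm_sum _ _ _) _.
  apply: (@le_trans _ _ (\sum_(i < N n) `|c n i| * (A / (B n * n.+1%:R)))); last first.
    rewrite -mulr_suml mulrCA ler_wpM2l// invfM mulrA ler_piMl//.
    by rewrite ler_pdivrMr// mul1r /B lerDr.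
  apply: ler_sum => i _; have [->|cn] := eqVneq (c n i) 0.
    by rewrite !mul0r subrr normr0 mul0r.
  have sx : 0 < s (x n i) by apply: s0; exact: c01.
  set J := int01 _.
  have -> : c n i / s (x n i) * J - c n i * phi (x n i) =
      c n i * ((J - s (x n i) * phi (x n i)) / s (x n i)).
    by field; rewrite lt0r_neq0.
  rewrite normrM ler_wpM2l// normrM normfV (gtr0_norm sx) ler_pdivrMr//.
  have := Hr (n, nat_of_ord i) cn (fun z => s z * phi z) ((1 + S) * A) csphi.
  have -> : A / (B n * n.+1%:R) * s (x n i) = e n i * ((1 + S) * A).
    have q0 : B n * n.+1%:R != 0 by rewrite lt0r_neq0// mulr_gt0.
    have S1 : 1 + S != 0 by rewrite lt0r_neq0// ltr_wpDr.
    by rewrite /e; move: (B n * n.+1%:R) q0 => q q0; field; rewrite q0 S1.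
  apply => z _.
  apply: (@is_derive_lip R (fun z => s z * phi z)
     (fun z => ds z * phi z + s z * derive1 phi z)) => t _; split.
    exact: is_derive_mul.
  apply: le_trans (ler_normD _ _) _; rewrite !normrM mulrDl mul1r addrC.
  apply: lerD; last by apply: ler_pM => //; exact: (HA 0%N).
  by rewrite -[leRHS]mul1r; apply: ler_pM => //; exact: (HA 1%N).
have Alim : A * n.+1%:R^-1 @[n --> \oo] --> (0 : R).
  by rewrite -[X in _ --> X](mulr0 A); apply: cvgZr; exact: cvg_harmonic.
apply/cvgrPdist_le => eps eps0; near=> n.
rewrite (splitr eps) -(subrK (\sum_(i < N n) c n i * phi (x n i)) (u phi)) -addrA.
apply: le_trans (ler_normD _ _) _; apply: lerD.
  by near: n; move/cvgrPdist_le : (cu phi tphi); apply; rewrite divr_gt0.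
rewrite distrC; apply: le_trans (main n) _.
by near: n; apply: (cvgr_le _ Alim); rewrite divr_gt0.
Unshelve. all: by end_near. Qed.

End PolynomialApproximation.

(** * The wave equation with trigonometric data *)

Section GeometricSeries.
Variable R : realType.
Implicit Types (a b : nat -> R) (C : R).

Definition geom_le C a := forall j, `|a j| <= C * 2^-1 ^+ j.

Definition ser a : R := limn (series a).

Lemma geom_le_cvg C a : geom_le C a -> cvgn (series a).
Proof.
move=> aC; apply: normed_cvg; apply: (series_le_cvg (v_ := geometric C 2^-1)) => //.
- by move=> n /=.
- by move=> n; rewrite /geometric/=; exact: le_trans (normr_ge0 _) (aC n).
- apply: is_cvg_geometric_series; rewrite ger0_norm; lra.
Qed.

Lemma serD C D a b : geom_le C a -> geom_le D b ->
  ser (fun j => a j + b j) = ser a + ser b.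
Proof.
move=> /geom_le_cvg ca /geom_le_cvg cb; rewrite /ser -limD//; congr (limn _).
by apply/funext => n; rewrite /series/= big_split.
Qed.

Lemma serZ C (k : R) a : geom_le C a -> ser (fun j => k * a j) = k * ser a.
Proof.
move=> /geom_le_cvg ca; rewrite {1}/ser.
have -> : series (fun j => k * a j) = fun n => k * series a n.
  by apply/funext => n; rewrite /series/= mulr_sumr.
by apply: cvg_lim => //; apply: cvgM; [exact: cvg_cst|exact: ca].
Qed.

Lemma serB C D a b : geom_le C a -> geom_le D b ->
  ser (fun j => a j - b j) = ser a - ser b.
Proof.
move=> ca cb; rewrite -[- ser b]mulN1r -(serZ _ cb) -(serD ca (D := D)).
  by congr ser; apply/funext => j; rewrite mulN1r.
by move=> j; rewrite mulN1r normrN.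
Qed.

Lemma ser_le C a : geom_le C a -> `|ser a| <= 2 * C.
Proof.
move=> aC; have C0 : 0 <= C.
  by have := aC 0%N; rewrite expr0 mulr1; exact: (le_trans (normr_ge0 _)).
have ca := geom_le_cvg aC.
have /cvg_norm cn := ca; rewrite /ser -(cvg_lim _ cn)//.
apply: limr_le; first by apply/cvg_ex; exists `|limn (series a)|.
apply: nearW => n; rewrite /series/=; apply: le_trans (ler_norm_sum _ _ _) _.
apply: (@le_trans _ _ (\sum_(0 <= i < n) C * 2^-1 ^+ i)); first exact: ler_sum.
rewrite -mulr_sumr mulrC ler_wpM2r//.
suff -> : \sum_(0 <= i < n) 2^-1 ^+ i = 2 - 2 * 2^-1 ^+ n :> R.
  by have : 0 <= 2^-1 ^+ n :> R by []; lra.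
elim: n => [|n IH]; first by rewrite big_nil expr0; lra.
by rewrite big_nat_recr//= IH exprS; lra.
Qed.

Lemma geom_le_shift C a J : geom_le C a ->
  geom_le (C * 2^-1 ^+ J) (fun j => a (J + j)%N).
Proof. by move=> aC j; rewrite -mulrA -exprD. Qed.

Lemma ser_split C a J : geom_le C a ->
  ser a = \sum_(j < J) a j + ser (fun j => a (J + j)%N).
Proof.
move=> aC; have ca := geom_le_cvg aC.
have cs := geom_le_cvg (geom_le_shift J aC).
have : series a (n + J)%N @[n --> \oo] --> ser a by rewrite cvg_shiftn; exact: ca.
have -> : (fun n => series a (n + J)%N) =
    (fun n => \sum_(j < J) a j + series (fun j => a (J + j)%N) n).
  apply/funext => n; rewrite /series/= (big_cat_nat _ (n := J))//= ?leq_addl//.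
  rewrite big_mkord; congr (_ + _); rewrite -{1}[J]add0n big_addn addnK.
  by apply: eq_bigr => i _; rewrite addnC.
move=> h; apply: (cvg_unique _ h) => //.
by apply: cvgD; [exact: cvg_cst|exact: cs].
Qed.

(** A finite part is differentiated term by term. In the tail the mean value inequality bounds every
    difference quotient by the geometric bound on [g], uniformly in the increment. *)
Lemma ser_is_derive (f g : nat -> R -> R) C (x : R) :
  (forall j (y : R), is_derive y 1 (f j) (g j y)) ->
  (forall y, `|y - x| <= 1 -> geom_le C (f^~ y)) ->
  (forall y, `|y - x| <= 1 -> geom_le C (g^~ y)) ->
  is_derive x 1 (fun y => ser (f^~ y)) (ser (g^~ x)).
Proof.
move=> fD fC gC.
have xx : `|x - x| <= 1 by rewrite subrr normr0.
have C0 : 0 <= C by have := fC x xx 0%N; rewrite expr0 mulr1; exact: (le_trans (normr_ge0 _)).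
have L : h^-1 *: (ser (f^~ (h *: 1 + x)) - ser (f^~ x)) @[h --> 0^'] --> ser (g^~ x).
  apply/cvgrPdist_le => e e0.
  (* Two tails occur, that of the derivatives and that of the difference quotients, each at most
     [2 * C * 2^-1 ^+ J] by [ser_le]. *)
  have [J HJ] : exists J, 4 * C * 2^-1 ^+ J <= e / 2.
    have lim : 4 * C * 2^-1 ^+ n @[n --> \oo] --> (0 : R).
      rewrite -[X in _ --> X](mulr0 (4 * C)); apply: cvgZr; apply: cvg_expr.
      by rewrite ger0_norm; lra.
    have e20 : 0 < e / 2 by rewrite divr_gt0.
    have [J _ HJ] := cvgr_le _ lim _ e20.
    by exists J; apply: HJ => /=.
  pose S y := \sum_(j < J) f j y.
  have SD : is_derive x 1 S (\sum_(j < J) g j x) by exact: is_derive_bigsum.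
  have SL : h^-1 *: (S (h *: 1 + x) - S x) @[h --> 0^'] --> \sum_(j < J) g j x.
    by have [d1 <-] := SD.
  have SL' : \forall h \near 0^', `|\sum_(j < J) g j x - h^-1 *: (S (h *: 1 + x) - S x)| <= e / 2.
    by move/cvgrPdist_le : SL; apply; rewrite divr_gt0.
  near=> h.
  have h0 : h != 0 by near: h; exact: nbhs_dnbhs_neq.
  have h1 : `|h| <= 1 by near: h; apply: dnbhs0_le.
  have hx : `|h *: 1 + x - x| <= 1 by rewrite addrK /GRing.scale/= mulr1.
  rewrite (ser_split J (gC x xx)) (ser_split J (fC _ hx)) (ser_split J (fC x xx)).
  rewrite -!/(S _); set tg := ser _; set tfh := ser _; set tf := ser _.
  have -> : \sum_(j < J) g j x + tg - h^-1 *: (S (h *: 1 + x) + tfh - (S x + tf)) =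
     (\sum_(j < J) g j x - h^-1 *: (S (h *: 1 + x) - S x)) + (tg - h^-1 * (tfh - tf)).
    by rewrite /GRing.scale/=; ring.
  apply: le_trans (ler_normD _ _) _; rewrite [leRHS]splitr; apply: lerD.
    by near: h.
  apply: le_trans HJ; apply: le_trans (ler_normB _ _) _.
  have -> : 4 * C * 2^-1 ^+ J = 2 * (C * 2^-1 ^+ J) + 2 * (C * 2^-1 ^+ J) by ring.
  apply: lerD; first by apply: ser_le; exact: geom_le_shift (gC x xx).
  rewrite normrM normfV ler_pdivrMl ?normr_gt0//.
  rewrite -(serB (geom_le_shift J (fC _ hx)) (geom_le_shift J (fC _ xx))).
  rewrite mulrCA; apply: ser_le => j.
  have -> : `|h| * (C * 2^-1 ^+ J) * 2^-1 ^+ j = C * 2^-1 ^+ J * 2^-1 ^+ j * `|h| by ring.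
  have := @is_derive_lip R (f (J + j)%N) (g (J + j)%N) x (h *: 1 + x) (C * 2^-1 ^+ J * 2^-1 ^+ j).
  rewrite addrK /GRing.scale/= mulr1; apply=> y yx.
  split => //; rewrite -mulrA -exprD; apply: gC.
  have h1' := h1; move: h1'; rewrite ler_norml => /andP[? ?].
  move: yx; case: (leP x (h + x)) => _ /andP[? ?];
    by rewrite ler_norml; apply/andP; split; lra.
split; first by apply/cvg_ex; exists (ser (g^~ x)).
exact: (cvg_lim (@norm_hausdorff _ _) L).
Unshelve. all: by end_near. Qed.

End GeometricSeries.

Section Oscillator.
Variable R : realType.

(** For positive times K/k exp(kt) - F(t) has a nonnegative derivative and starts at K/k >= 0.
    Applying this to - F gives the lower bound, and reflecting time gives the negative times. *)
Lemma primitive_expR_bound (F g : R -> R) (K k : R) : 0 < k -> F 0 = 0 ->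
  (forall t : R, is_derive t 1 F (g t)) ->
  (forall t, `|g t| <= K * expR (k * `|t|)) ->
  forall t, `|F t| <= K / k * expR (k * `|t|).
Proof.
move=> k0.
have K0 (g' : R -> R) : (forall t, `|g' t| <= K * expR (k * `|t|)) -> 0 <= K.
  by move/(_ 0); rewrite normr0 mulr0 expR0 mulr1; exact: (le_trans (normr_ge0 _)).
have up (G g' : R -> R) : G 0 = 0 -> (forall t : R, is_derive t 1 G (g' t)) ->
    (forall t, `|g' t| <= K * expR (k * `|t|)) ->
    forall t, 0 <= t -> G t <= K / k * expR (k * t).
  move=> G0 GD gK t t0.
  have Kk : 0 <= K / k by rewrite divr_ge0 ?(K0 _ gK)// ltW.
  pose H s := K / k * expR (k * s + 0) - G s.
  have HD (s : R) : is_derive s 1 H (K / k * (k * expR (k * s + 0)) - g' s).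
    apply: is_derive_sub => //; apply: is_derive_scale; exact: is_derive_affine.
  have [c /andP[c0 ct]] := @is_derive_MVT R H _ 0 t t0 (fun s _ => HD s).
  have -> : K / k * (k * expR (k * c + 0)) = K * expR (k * c).
    by rewrite addr0; field; rewrite lt0r_neq0.
  rewrite /H G0 mulr0 !addr0 expR0 => E.
  have := gK c; rewrite (ger0_norm c0) ler_norml => /andP[_ gc].
  have : 0 <= (K * expR (k * c) - g' c) * (t - 0).
    by rewrite mulr_ge0// subr_ge0.
  by rewrite -E; lra.
have up2 (G g' : R -> R) : G 0 = 0 -> (forall t : R, is_derive t 1 G (g' t)) ->
    (forall t, `|g' t| <= K * expR (k * `|t|)) ->
    forall t, 0 <= t -> `|G t| <= K / k * expR (k * t).
  move=> G0 GD gK t t0; rewrite ler_norml; apply/andP; split; last exact: (up G g').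
  rewrite lerNl; apply: (up (fun s => - G s) (fun s => - g' s)) => //.
  - by rewrite G0 oppr0.
  - by move=> s; rewrite normrN.
move=> F0 FD gK t; have [t0|/ltW t0] := leP 0 t.
  by rewrite (ger0_norm t0); exact: (up2 F g).
rewrite (ler0_norm t0).
have := up2 (fun s => F (-1 * s + 0)) (fun s => -1 * g (-1 * s + 0)).
rewrite mulr0 addr0 => /(_ F0) h.
have := h _ _ (- t); rewrite mulN1r opprK addr0; apply.
- by move=> s; exact: is_derive_affine.
- by move=> s; rewrite addr0 !mulN1r normrN (le_trans (gK _))// normrN.
- by rewrite oppr_ge0.
Qed.

(* Duhamel's formula: [y = (sin (l t) A - cos (l t) B) / l] where [A] and [B]
   are the primitives of [cos (l t) f] and [sin (l t) f]. *)
Lemma oscillator (l : R) (f : R -> R) : 1 <= l -> continuous f ->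
  exists yz : (R -> R) * (R -> R), [/\ yz.1 0 = 0, yz.2 0 = 0,
    forall t : R, is_derive t 1 yz.1 (yz.2 t),
    forall t : R, is_derive t 1 yz.2 (f t - l ^+ 2 * yz.1 t) &
    forall K k, 0 < k -> (forall t, `|f t| <= K * expR (k * `|t|)) ->
      forall t, `|yz.1 t| <= 2 * (K / k) * expR (k * `|t|) /\
                `|yz.2 t| <= 2 * (K / k) * expR (k * `|t|)].
Proof.
move=> l1 cf; have l0 : l != 0 by rewrite lt0r_neq0//; lra.
pose cs (t : R) := cos (l * t + 0); pose sn (t : R) := sin (l * t + 0).
have csD (t : R) : is_derive t 1 cs (l * - sn t).
  exact: is_derive_affine.
have snD (t : R) : is_derive t 1 sn (l * cs t).
  exact: is_derive_affine.
have ccs : continuous (fun t => cs t * f t).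
  by move=> t; apply: cvgM; [exact: is_derive_continuous (csD t)|exact: cf].
have csn : continuous (fun t => sn t * f t).
  by move=> t; apply: cvgM; [exact: is_derive_continuous (snD t)|exact: cf].
have [A A0 AD] := exists_primitive ccs.
have [B B0 BD] := exists_primitive csn.
have cs2 t : cs t ^+ 2 + sn t ^+ 2 = 1 by exact: cos2Dsin2.
exists (fun t => l^-1 * (sn t * A t - cs t * B t), fun t => cs t * A t + sn t * B t).
split => /= [||t|t|K k k0 fK t].
- by rewrite A0 B0 !mulr0 subr0 mulr0.
- by rewrite A0 B0 !mulr0 addr0.
- apply: (is_derive_eq (is_derive_scale l^-1 (is_derive_sub
    (is_derive_mul (snD t) (AD t)) (is_derive_mul (csD t) (BD t))))).
  by field.
- apply: (is_derive_eq (is_derive_add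
    (is_derive_mul (csD t) (AD t)) (is_derive_mul (snD t) (BD t)))).
  by rewrite -[in RHS](mul1r (f t)) -(cs2 t); field.
have bA : `|A t| <= K / k * expR (k * `|t|).
  apply: (primitive_expR_bound k0 A0 AD) => s; rewrite normrM.
  by apply: le_trans (fK s); rewrite ler_piMl// cos_max.
have bB : `|B t| <= K / k * expR (k * `|t|).
  apply: (primitive_expR_bound k0 B0 BD) => s; rewrite normrM.
  by apply: le_trans (fK s); rewrite ler_piMl// sin_max.
have c1 : `|cs t| <= 1 by exact: cos_max.
have s1 : `|sn t| <= 1 by exact: sin_max.
have -> : 2 * (K / k) * expR (k * `|t|) =
  K / k * expR (k * `|t|) + K / k * expR (k * `|t|) by ring.
have mb (a b : R) : `|a| <= 1 -> `|b| <= K / k * expR (k * `|t|) ->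
    `|a * b| <= K / k * expR (k * `|t|).
  by move=> a1 bK; rewrite normrM; apply: le_trans bK; rewrite ler_piMl.
split.
  rewrite normrM -[leRHS]mul1r; apply: ler_pM => //.
    by rewrite ger0_norm ?invr_ge0 ?invf_le1//; lra.
  by apply: le_trans (ler_normB _ _) _; apply: lerD; exact: mb.
by apply: le_trans (ler_normD _ _) _; apply: lerD; exact: mb.
Qed.

End Oscillator.

Section SineSums.
Variable R : realType.
Implicit Types (c : nat -> R) (s : seq R).

Definition freq (m : nat) : R := m.+1%:R * pi.

Definition sinsum (L : nat) c (x : R) : R := \sum_(m < L) c m * sin (freq m * x).

(* Multiplication by [cos (pi x)], read on the coefficients of a sine sum. *)
Definition jacobi c (m : nat) : R := ((if m is l.+1 then c l else 0) + c m.+1) / 2.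

(** Horner's scheme with [jacobi] in place of the variable; the recursion follows that of
    [horner_rec]. *)
Fixpoint jacobi_horner s c : nat -> R :=
  if s is a :: s' then fun m => a * c m + jacobi (jacobi_horner s' c) m
  else fun=> 0.

Definition vanishes_from (L : nat) c := forall m, (L <= m)%N -> c m = 0.

Lemma freq_ge1 m : 1 <= freq m.
Proof.
apply: (@le_trans _ _ pi); first by have := pi_ge2 R; lra.
by rewrite ler_peMl ?pi_ge0// ler1n.
Qed.

Lemma freq_le m : freq m <= 4 * m.+1%:R.
Proof. by rewrite /freq [leRHS]mulrC ler_wpM2l//; have := pihalf_lt2 R; lra. Qed.

Lemma sinsum_widen L L' c x : vanishes_from L c -> (L <= L')%N ->
  sinsum L' c x = sinsum L c x.
Proof.
move=> cL LL'; rewrite /sinsum -(big_mkord xpredT (fun m => c m * sin (freq m * x))).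
rewrite (big_cat_nat _ (n := L))//= big_mkord [X in _ + X]big_nat_cond [X in _ + X]big1 ?addr0//.
by move=> i /andP[/andP[Li _] _]; rewrite cL// mul0r.
Qed.

Lemma sinsum_jacobi L c x : vanishes_from L c ->
  cos (pi * x) * sinsum L c x = sinsum L.+1 (jacobi c) x.
Proof.
move=> cL.
have -> : sinsum L.+1 (jacobi c) x = 2^-1 *
    (\sum_(m < L.+1) (if (m : nat) is l.+1 then c l else 0) * sin (freq m * x)
     + \sum_(m < L.+1) c m.+1 * sin (m.+1%:R * (pi * x))).
  rewrite -big_split mulr_sumr; apply: eq_bigr => m _.
  have -> : freq m * x = m.+1%:R * (pi * x) by rewrite /freq mulrA.
  by rewrite /jacobi /= -mulrDl [RHS]mulrA; congr (_ * _); exact: mulrC.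
(* The sum shifted down gains a term of frequency 0, which is zero, and loses its last two terms,
   where [c] vanishes. Both shifts then combine by sin (a + b) + sin (a - b) = 2 sin a cos b. *)
have -> : \sum_(m < L.+1) c m.+1 * sin (m.+1%:R * (pi * x)) =
    \sum_(m < L) c m * sin (m%:R * (pi * x)).
  have -> : \sum_(m < L.+1) c m.+1 * sin (m.+1%:R * (pi * x)) =
      \sum_(m < L.+2) c m * sin (m%:R * (pi * x)).
    by rewrite [RHS]big_ord_recl /= mul0r sin0 mulr0 add0r.
  by rewrite !big_ord_recr /= !cL// !mul0r !addr0.
rewrite big_ord_recl /= mul0r add0r -big_split /= mulr_sumr mulr_sumr.
apply: eq_bigr => m _; rewrite /freq -!mulrA.
set a := pi * x; have -> : bump 0 m = m.+1 by [].
have -> : m.+2%:R * a = m.+1%:R * a + a by rewrite -[m.+2%:R]natr1; ring.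
have -> : m%:R * a = m.+1%:R * a - a by rewrite -[m.+1%:R]natr1; ring.
by rewrite sinD sinB; field.
Qed.

Lemma jacobi_vanishes L c : vanishes_from L c -> vanishes_from L.+1 (jacobi c).
Proof.
by move=> cL [|m]//; rewrite ltnS => Lm; rewrite /jacobi !cL ?addr0 ?mul0r// 2?leqW.
Qed.

Lemma jacobi_horner_vanishes s L c : vanishes_from L c ->
  vanishes_from (L + size s) (jacobi_horner s c).
Proof.
move=> cL; elim: s => [|a s IH] m //=.
rewrite addnS => Lm; rewrite cL ?mulr0 ?add0r.
  exact: jacobi_vanishes IH _ Lm.
by rewrite (leq_trans _ Lm)// leqW// leq_addr.
Qed.

Lemma sinsum_jacobi_horner s L c x : vanishes_from L c ->
  horner_rec s (cos (pi * x)) * sinsum L c x = sinsum (L + size s) (jacobi_horner s c) x.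
Proof.
move=> cL; elim: s => [|a s IH] /=.
  by rewrite mul0r /sinsum big1// => i _; rewrite mul0r.
rewrite mulrDl -mulrA [cos _ * sinsum _ _ _]mulrC mulrA IH mulrC.
rewrite sinsum_jacobi ?addnS; last exact: jacobi_horner_vanishes.
rewrite -(@sinsum_widen L (L + size s).+1 c x)//; last by rewrite leqW// leq_addr.
rewrite /sinsum mulr_sumr -big_split; apply: eq_bigr => m _ /=; ring.
Qed.

(** [jacobi] averages two coefficients, or one and zero, and so does not increase the supremum. *)
Lemma jacobi_horner_le s c B : (forall m, `|c m| <= B) ->
  forall m, `|jacobi_horner s c m| <= (\sum_(a <- s) `|a|) * B.
Proof.
move=> cB; have B0 : 0 <= B by apply: le_trans (cB 0%N).
elim: s => [|a s IH] m /=; first by rewrite normr0 big_nil mul0r.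
rewrite big_cons mulrDl; apply: le_trans (ler_normD _ _) _; apply: lerD.
  by rewrite normrM ler_wpM2l.
rewrite /jacobi normrM (gtr0_norm (_ : 0 < 2^-1))// ler_pdivrMr//.
apply: le_trans (ler_normD _ _) _; rewrite mulr_natr mulr2n; apply: lerD => //.
by case: m => // ; rewrite normr0 mulr_ge0// sumr_ge0.
Qed.

Lemma jacobi_horner_continuous s (y : nat -> R -> R) :
  (forall m, continuous (y m)) ->
  forall m, continuous (fun t => jacobi_horner s (y^~ t) m).
Proof.
move=> cy; elim: s => [|a s IH] m t /=; first exact: cvg_cst.
apply: cvgD; first by apply: cvgM; [exact: cvg_cst|exact: cy].
apply: cvgM; last exact: cvg_cst.
by apply: cvgD; [case: m => [|m]; [exact: cvg_cst|exact: IH]|exact: IH].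
Qed.

End SineSums.

(** * The Dyson series *)

Section Wave.
Variable R : realType.

Lemma sin_natpi (n : nat) : sin (n%:R * pi) = 0 :> R.
Proof.
elim: n => [|n IH]; first by rewrite mul0r sin0.
by rewrite -natr1 mulrDl mul1r sinDpi IH oppr0.
Qed.

Section Terms.
Variables (p : {poly R}) (L : nat) (b0 b1 : nat -> R).
Hypotheses (b0L : vanishes_from L b0) (b1L : vanishes_from L b1).

Let D := size p.
Let A := \sum_(a <- p) `|a|.
(** One step of the series costs [A] for the multiplication by the potential and 2/k for the
    oscillator; this value makes the product 2A/k at most 1/64. *)
Let k := 128 * A + 1.
Let B := \sum_(m < L) (freq R m * `|b0 m| + `|b1 m|).
Let Len (j : nat) := (L + j * D)%N.
Let E (t : R) := expR (k * `|t|).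

Let A0 : 0 <= A. Proof. exact: sumr_ge0. Qed.
Let B0 : 0 <= B.
Proof.
apply: sumr_ge0 => m _; rewrite addr_ge0// mulr_ge0//.
exact: le_trans (freq_ge1 R m).
Qed.
Let k0 : 0 < k. Proof. by rewrite ltr_wpDl// mulr_ge0. Qed.
Let E1 t : 1 <= E t.
Proof. by rewrite -expR0 ler_expR mulr_ge0// ltW. Qed.

Let forcing (y : nat -> nat -> R -> R) (j m : nat) (t : R) : R :=
  if j is j'.+1 then - jacobi_horner p (fun l => y j' l t) m else 0.

(* The [j]-th term of the Dyson series, a finite sine sum in [x], solves
   [w_j,tt - w_j,xx = - q w_(j-1)] with zero initial data for [j > 0]; its
   coefficients and their time derivatives are [y j] and [z j]. *)
Let exists_coefficients : exists y z : nat -> nat -> R -> R,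
  [/\ forall j m (t : R), is_derive t 1 (y j m) (z j m t),
      forall j m (t : R), is_derive t 1 (z j m)
        (forcing y j m t - freq R m ^+ 2 * y j m t),
      forall j m, y j m 0 = (if j is 0 then b0 m else 0) /\
                  z j m 0 = (if j is 0 then b1 m else 0),
      forall j t, vanishes_from (Len j) (fun m => y j m t) /\
                  vanishes_from (Len j) (fun m => z j m t) &
      forall j m t, `|y j m t| <= B * 64^-1 ^+ j * E t /\
                    `|z j m t| <= B * 64^-1 ^+ j * E t].
Proof.
(* The hypotheses on frequency and forcing stand behind the existential so that [choice] yields a
   total solution operator; the zero pair is the default. *)
have /choice[sol Hsol] : forall lf : R * (R -> R),
  exists yz : (R -> R) * (R -> R), 1 <= lf.1 -> continuous lf.2 ->
  [/\ yz.1 0 = 0, yz.2 0 = 0,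
    forall t : R, is_derive t 1 yz.1 (yz.2 t),
    forall t : R, is_derive t 1 yz.2 (lf.2 t - lf.1 ^+ 2 * yz.1 t) &
    forall K k, 0 < k -> (forall t, `|lf.2 t| <= K * expR (k * `|t|)) ->
      forall t, `|yz.1 t| <= 2 * (K / k) * expR (k * `|t|) /\
                `|yz.2 t| <= 2 * (K / k) * expR (k * `|t|)].
  move=> [l f] /=; have [[l1 cf]|h] := pselect (1 <= l /\ continuous f).
    by have [yz Hyz] := oscillator l1 cf; exists yz.
  by exists (cst 0, cst 0) => l1 cf; exfalso; exact: h.
pose Y0 m : (R -> R) * (R -> R) :=
  (fun t => b0 m * cos (freq R m * t + 0) + b1 m / freq R m * sin (freq R m * t + 0),
   fun t => b1 m * cos (freq R m * t + 0) - b0 m * freq R m * sin (freq R m * t + 0)).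
pose next (Y : nat -> (R -> R) * (R -> R)) m :=
  sol (freq R m, fun t => - jacobi_horner p (fun l => (Y l).1 t) m).
pose Y j := iter j next Y0.
pose y j m := (Y j m).1; pose z j m := (Y j m).2.
have fr0 m : freq R m != 0.
  by rewrite lt0r_neq0// (lt_le_trans ltr01)// freq_ge1.
have D0 m (t : R) : is_derive t 1 (y 0 m) (z 0 m t) /\
    is_derive t 1 (z 0 m) (forcing y 0 m t - freq R m ^+ 2 * y 0 m t).
  have c := @is_derive_affine R (@cos R) t _ (freq R m) 0 (is_derive_cos _).
  have s := @is_derive_affine R (@sin R) t _ (freq R m) 0 (is_derive_sin _).
  split.
    apply: (is_derive_eq (is_derive_add (is_derive_scale (b0 m) c)
      (is_derive_scale (b1 m / freq R m) s))).
    by rewrite /z /=; field.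
  apply: (is_derive_eq (is_derive_sub (is_derive_scale (b1 m) c)
    (is_derive_scale (b0 m * freq R m) s))).
  by rewrite /y /=; field.
have cforce j m : (forall l (t : R), is_derive t 1 (y j l) (z j l t)) ->
    continuous (fun t => - jacobi_horner p (fun l => y j l t) m).
  move=> yD t; apply: cvgN.
  apply: (@jacobi_horner_continuous R p (y j)) => l s.
  exact: is_derive_continuous (yD l s).
have yzD j : (forall m (t : R), is_derive t 1 (y j m) (z j m t)) /\
    (forall m (t : R), is_derive t 1 (z j m)
      (forcing y j m t - freq R m ^+ 2 * y j m t)).
  elim: j => [|j [IH _]]; first by split=> m t; have [] := D0 m t.
  by split=> m t; have [_ _ h1 h2 _] := Hsol (freq R m, _) (freq_ge1 R m) (cforce j m IH);
    [exact: h1|exact: h2].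
have solS j m := Hsol (freq R m, _) (freq_ge1 R m) (cforce j m (yzD j).1).
have yzB j : forall m t, `|y j m t| <= B * 64^-1 ^+ j * E t /\
                    `|z j m t| <= B * 64^-1 ^+ j * E t.
  elim: j => [|j IH] m t.
    rewrite expr0 mulr1.
    have [mL|Lm] := ltnP m L; last first.
      have BE : 0 <= B * E t by rewrite mulr_ge0// (le_trans ler01 (E1 t)).
      by rewrite /y /z /= b0L// b1L// !mul0r addr0 subr0 normr0.
    have bB : freq R m * `|b0 m| + `|b1 m| <= B * E t.
      apply: (@le_trans _ _ B).
        rewrite /B (bigD1 (Ordinal mL))//= lerDl; apply: sumr_ge0 => i _.
        by rewrite addr_ge0// mulr_ge0// (le_trans ler01)// freq_ge1.
      by rewrite ler_peMr.
    have f1 := freq_ge1 R m; have f0 : 0 < freq R m by exact: lt_le_trans f1.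
    have c1 := cos_max (freq R m * t + 0); have s1 := sin_max (freq R m * t + 0).
    split; apply: le_trans bB; rewrite /y /z /=.
      apply: le_trans (ler_normD _ _) _; rewrite !normrM.
      apply: lerD.
        by rewrite mulrC ler_wpM2r// (le_trans c1 f1).
      rewrite -[leRHS]mulr1; apply: ler_pM => //; rewrite ?mulr_ge0//.
      by rewrite ler_piMr// ger0_norm ?invf_le1// invr_ge0 ltW.
    apply: le_trans (ler_normB _ _) _.
    rewrite (normrM (b1 m)) (normrM (b0 m * _)) (normrM (b0 m)) addrC (gtr0_norm f0); apply: lerD; last by rewrite ler_piMr.
    rewrite [leRHS]mulrC -[leRHS]mulr1; apply: ler_wpM2l => //.
    by rewrite mulr_ge0// ltW.
  have [_ _ _ _ h] := solS j m.
  have fB s : `|- jacobi_horner p (fun l => y j l s) m| <= A * (B * 64^-1 ^+ j) * E s.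
    rewrite normrN -mulrA; apply: jacobi_horner_le => l.
    by have [] := IH l s.
  have B0j : 0 <= B * 64^-1 ^+ j by rewrite mulr_ge0// exprn_ge0.
  have K : 2 * (A * (B * 64^-1 ^+ j) / k) <= B * 64^-1 ^+ j.+1.
    have -> : 2 * (A * (B * 64^-1 ^+ j) / k) = (2 * A / k) * (B * 64^-1 ^+ j).
      by field; rewrite lt0r_neq0.
    have -> : B * 64^-1 ^+ j.+1 = 64^-1 * (B * 64^-1 ^+ j) by rewrite exprS; ring.
    by rewrite ler_wpM2r// ler_pdivrMr// /k; lra.
  have [h1 h2] := h _ _ k0 fB t.
  by split; [apply: le_trans h1 _|apply: le_trans h2 _];
    rewrite ler_wpM2r// (le_trans ler01 (E1 t)).
exists y, z; split.
- by move=> j; have [] := yzD j.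
- by move=> j; have [] := yzD j.
- move=> [|j] m; last by have [h1 h2 _ _ _] := solS j m.
  rewrite /y /z /= !mulr0 !addr0 sin0 cos0 !mulr0 !mulr1 addr0 subr0.
  by [].
- elim=> [|j IH] t.
    by split=> m; rewrite /Len mul0n addn0 => Lm; rewrite /y /z /= b0L// b1L//;
      rewrite !mul0r ?subr0 ?addr0.
  have fz m : (Len j.+1 <= m)%N -> forall s, - jacobi_horner p (fun l => y j l s) m = 0.
    move=> Lm s; rewrite (jacobi_horner_vanishes (IH s).1) ?oppr0//.
    by rewrite /Len mulSn [(D + _)%N]addnC addnA in Lm.
  (* Zero forcing gives the zero solution by the estimate itself, taken with [K = 0]. *)
  have van m : (Len j.+1 <= m)%N -> `|y j.+1 m t| <= 0 /\ `|z j.+1 m t| <= 0.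
    move=> Lm; have [_ _ _ _ h] := solS j m.
    have [s|h1 h2] := h 0 1 ltr01 _ t; first by rewrite /= fz// normr0 mul0r.
    by rewrite !(mul0r, mulr0) in h1 h2.
  by split=> m /van[h1 h2]; apply/eqP; rewrite -normr_le0.
- exact: yzB.
Qed.

(** The equation telescopes: the wave operator kills the term of order 0 and sends the term of order
    j + 1 to minus the potential times the term of order j. *)
Theorem wave_solution : exists w wt wtt wx wxx : R -> R -> R,
  [/\ forall t x : R, [/\ is_derive t 1 (w^~ x) (wt t x),
        is_derive t 1 (wt^~ x) (wtt t x), is_derive x 1 (w t) (wx t x),
        is_derive x 1 (wx t) (wxx t x) &
        wtt t x - wxx t x + p.[cos (pi * x)] * w t x = 0],
      forall x, w 0 x = sinsum L b0 x /\ wt 0 x = sinsum L b1 x,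
      forall t, w t 0 = 0 /\ w t 1 = 0 &
      forall T, exists K, forall t x, `|t| <= T -> `|w t x| <= K /\ `|wt t x| <= K].
Proof.
have [y [z [yD zD init van bnd]]] := exists_coefficients.
pose w_ j t x := sinsum (Len j) (fun m => y j m t) x.
pose wt_ j t x := sinsum (Len j) (fun m => z j m t) x.
pose wtt_ j t x := sinsum (Len j) (fun m => forcing y j m t - freq R m ^+ 2 * y j m t) x.
pose wx_ j t x := \sum_(m < Len j) y j m t * (freq R m * cos (freq R m * x + 0)).
pose wxx_ j t x := sinsum (Len j) (fun m => - freq R m ^+ 2 * y j m t) x.
have sinE (a x : R) : sin (a * x) = sin (a * x + 0) by rewrite addr0.
have dw j (t x : R) : is_derive t 1 ((w_ j)^~ x) (wt_ j t x).
  apply: is_derive_bigsum => m.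
  apply: (is_derive_eq (is_derive_mul (yD j m t)
    (is_derive_cst (sin (freq R m * x)) t 1))).
  by rewrite mulr0 addr0.
have dwt j (t x : R) : is_derive t 1 ((wt_ j)^~ x) (wtt_ j t x).
  apply: is_derive_bigsum => m.
  apply: (is_derive_eq (is_derive_mul (zD j m t)
    (is_derive_cst (sin (freq R m * x)) t 1))).
  by rewrite mulr0 addr0.
have dx j (t x : R) : is_derive x 1 (w_ j t) (wx_ j t x).
  apply: is_derive_bigsum => m; apply: is_derive_scale.
  by under eq_fun do rewrite sinE; exact: is_derive_affine.
have dxx j (t x : R) : is_derive x 1 (wx_ j t) (wxx_ j t x).
  apply: is_derive_bigsum => m.
  have c := @is_derive_affine R (@cos R) x _ (freq R m) 0 (is_derive_cos _).
  apply: (is_derive_eq (is_derive_scale (y j m t) (is_derive_scale (freq R m) c))).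
  by rewrite addr0; ring.
have eq0 t x : wtt_ 0%N t x - wxx_ 0%N t x = 0.
  by rewrite /wtt_ /wxx_ /sinsum -sumrB big1// => m _ /=; ring.
have eqS j t x : wtt_ j.+1 t x - wxx_ j.+1 t x = - p.[cos (pi * x)] * w_ j t x.
  rewrite mulNr /w_ (sinsum_jacobi_horner p x (van j t).1).
  have -> : (Len j + size p)%N = Len j.+1 by rewrite /Len mulSn -addnA [(D + _)%N]addnC.
  by rewrite /wtt_ /wxx_ /sinsum -sumrB -sumrN; apply: eq_bigr => m _ /=; ring.
pose Lr : R := L%:R + D%:R + 1.
pose Cs := Lr * (16 * Lr ^+ 2 + 64 * A + 1) * B.
have Lr1 : 1 <= Lr by rewrite lerDr addr_ge0.
have Cs0 : 0 <= Cs.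
  by rewrite !mulr_ge0 ?addr_ge0 ?mulr_ge0 ?exprn_ge0//; lra.
(* One bound for all five series: [16 * Len^2] covers two frequency factors, [64 * A] the forcing,
   which carries one power of 1/64 less, and 1 the coefficients themselves. *)
have sum_le j t (a : nat -> R) (v : nat -> R) :
    (forall m, (m < Len j)%N -> `|a m| <= (16 * (Len j)%:R ^+ 2 + 64 * A + 1) * (B * 64^-1 ^+ j * E t)) ->
    (forall m, `|v m| <= 1) ->
    `|\sum_(m < Len j) a m * v m| <= Cs * E t * 2^-1 ^+ j.
  move=> aQ v1; set Q := 16 * _ + _ + 1 in aQ.
  apply: le_trans (ler_norm_sum _ _ _) _.
  apply: (@le_trans _ _ (\sum_(m < Len j) Q * (B * 64^-1 ^+ j * E t))).
    by apply: ler_sum => m _; rewrite normrM (le_trans _ (aQ m _))// ler_piMr.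
  rewrite sumr_const card_ord -[X in X <= _]mulr_natl.
  have V0 : 0 < 2^-1 ^+ j :> R by rewrite exprn_gt0.
  have V1 : 2^-1 ^+ j <= 1 :> R by rewrite exprn_ile1// invf_le1; lra.
  (* Of the six powers of 2^-j, one absorbs the number of frequencies, two the squared frequency,
     and one is kept as the geometric ratio; the last two are only bounded by 1. *)
  have -> : 64^-1 ^+ j = (2^-1 ^+ j) ^+ 6 :> R.
    by rewrite exprAC; congr (_ ^+ _); field.
  have LV : (Len j)%:R * 2^-1 ^+ j <= Lr.
    rewrite exprVn ler_pdivrMr ?exprn_gt0// natrD natrM.
    have jX : j%:R <= 2 ^+ j :> R by rewrite -natrX ler_nat ltnW// ltn_expl.
    have X1 : 1 <= 2 ^+ j :> R by rewrite exprn_ege1//; lra.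
    have h1 : j%:R * D%:R <= 2 ^+ j * D%:R :> R by rewrite ler_wpM2r.
    have h2 : 1 * L%:R <= 2 ^+ j * L%:R :> R by rewrite ler_wpM2r.
    have h3 : 0 <= 2 ^+ j :> R by lra.
    rewrite /Lr; lra.
  move: V0 V1 LV; set V := 2^-1 ^+ j; set l := (Len j)%:R => V0 V1 LV.
  have l0 : 0 <= l by [].
  have lV0 : 0 <= l * V by rewrite mulr_ge0// ltW.
  have QV : Q * V ^+ 2 <= 16 * Lr ^+ 2 + 64 * A + 1.
    have -> : Q * V ^+ 2 = 16 * (l * V) ^+ 2 + (64 * A + 1) * V ^+ 2 by rewrite /Q; ring.
    rewrite -addrA; apply: lerD.
      by rewrite ler_wpM2l// lerXn2r// nnegrE (le_trans ler01).
    have A1 : 0 <= 64 * A + 1 by have := A0; lra.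
    by rewrite ler_piMr// exprn_ile1// ltW.
  have Q0 : 0 <= Q by rewrite /Q !addr_ge0 ?mulr_ge0 ?exprn_ge0.
  have E0 : 0 <= E t by exact: le_trans (E1 t).
  have -> : l * (Q * (B * V ^+ 6 * E t)) = (l * V) * (Q * V ^+ 2) * (B * E t) * V * V ^+ 2 by ring.
  have -> : Cs * E t * V = Lr * (16 * Lr ^+ 2 + 64 * A + 1) * (B * E t) * V by rewrite /Cs; ring.
  apply: (@le_trans _ _ ((l * V) * (Q * V ^+ 2) * (B * E t) * V)).
    have V2 : V ^+ 2 <= 1 by rewrite exprn_ile1// ltW.
    rewrite ler_piMr//; apply: mulr_ge0; last exact: ltW.
    by apply: mulr_ge0; apply: mulr_ge0 => //; apply: mulr_ge0 => //; rewrite exprn_ge0// ltW.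
  rewrite ler_wpM2r ?(ltW V0)// ler_wpM2r ?mulr_ge0//.
  by apply: ler_pM => //; rewrite mulr_ge0// exprn_ge0// ltW.
have BE0 j t : 0 <= B * 64^-1 ^+ j * E t by rewrite !mulr_ge0 ?exprn_ge0 ?(le_trans ler01 (E1 t)).
have frq j m : (m < Len j)%N -> freq R m ^+ 2 <= 16 * (Len j)%:R ^+ 2.
  move=> mj; have -> : 16 * (Len j)%:R ^+ 2 = (4 * (Len j)%:R) ^+ 2 :> R by ring.
  rewrite lerXn2r ?nnegrE ?(le_trans ler01 (freq_ge1 R m))// ?mulr_ge0//.
  by apply: le_trans (freq_le R m) _; rewrite ler_wpM2l// ler_nat.
have gw t x : geom_le (Cs * E t) (fun j => w_ j t x).
  move=> j; apply: (sum_le _ _ (fun m => y j m t) (fun m => sin (freq R m * x))) => m; last exact: sin_max.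
  move=> mj; apply: le_trans (bnd j m t).1 _; rewrite ler_peMl// lerDr.
  by rewrite addr_ge0 ?mulr_ge0 ?exprn_ge0.
have gwt t x : geom_le (Cs * E t) (fun j => wt_ j t x).
  move=> j; apply: (sum_le _ _ (fun m => z j m t) (fun m => sin (freq R m * x))) => m; last exact: sin_max.
  move=> mj; apply: le_trans (bnd j m t).2 _; rewrite ler_peMl// lerDr.
  by rewrite addr_ge0 ?mulr_ge0 ?exprn_ge0.
have gwx t x : geom_le (Cs * E t) (fun j => wx_ j t x).
  move=> j; rewrite /wx_; under eq_bigr do rewrite mulrA.
  apply: (sum_le _ _ (fun m => y j m t * freq R m) (fun m => cos (freq R m * x + 0))) => m; last exact: cos_max.
  move=> mj; rewrite normrM mulrC; apply: ler_pM => //; last exact: (bnd j m t).1.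
  have f1 := freq_ge1 R m; rewrite ger0_norm ?(le_trans ler01)//.
  apply: (@le_trans _ _ (freq R m ^+ 2)); first by rewrite expr2 ler_peMl// (le_trans ler01).
  apply: le_trans (frq j m mj) _; have := A0; lra.
have gwxx t x : geom_le (Cs * E t) (fun j => wxx_ j t x).
  move=> j; apply: (sum_le _ _ (fun m => - freq R m ^+ 2 * y j m t) (fun m => sin (freq R m * x))) => m; last exact: sin_max.
  move=> mj; rewrite normrM normrN; apply: ler_pM => //; last exact: (bnd j m t).1.
  rewrite ger0_norm ?exprn_ge0 ?(le_trans ler01 (freq_ge1 R m))//.
  apply: le_trans (frq j m mj) _; have := A0; lra.
have gwtt t x : geom_le (Cs * E t) (fun j => wtt_ j t x).
  move=> j; apply: (sum_le _ _ (fun m => forcing y j m t - freq R m ^+ 2 * y j m t) (fun m => sin (freq R m * x))) => m; last exact: sin_max.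
  move=> mj; apply: le_trans (ler_normB _ _) _.
  apply: (@le_trans _ _ (64 * A * (B * 64^-1 ^+ j * E t) + 16 * (Len j)%:R ^+ 2 * (B * 64^-1 ^+ j * E t))); last first.
    by have := BE0 j t; set b := B * _ * _ => b0'; lra.
  apply: lerD.
    case: j mj => [|j] mj /=; first by rewrite normr0 mulr_ge0 ?BE0// mulr_ge0.
    rewrite normrN exprS.
    have -> : 64 * A * (B * (64^-1 * 64^-1 ^+ j) * E t) = A * (B * 64^-1 ^+ j * E t) by field.
    by apply: jacobi_horner_le => l; exact: (bnd j l t).1.
  rewrite normrM; apply: ler_pM => //; last exact: (bnd j m t).1.
  rewrite ger0_norm ?exprn_ge0 ?(le_trans ler01 (freq_ge1 R m))//.
  exact: frq.
have near_t t s : `|s - t| <= 1 -> Cs * E s <= Cs * expR (k * (`|t| + 1)).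
  move=> st; rewrite ler_wpM2l// ler_expR ler_pM2l// -[s](subrK t).
  by apply: le_trans (ler_normD _ _) _; rewrite addrC lerD2l.
have weaken C C' a : geom_le C a -> C <= C' -> geom_le C' a.
  by move=> aC CC' j; apply: le_trans (aC j) _; rewrite ler_wpM2r// exprn_ge0.
have ser0 : ser (fun=> 0 : R) = 0.
  have h : geom_le 0 (fun=> 0 : R) by move=> j; rewrite normr0 mul0r.
  by apply/eqP; have := ser_le h; rewrite mulr0 normr_le0.
exists (fun t x => ser (fun j => w_ j t x)), (fun t x => ser (fun j => wt_ j t x)),
  (fun t x => ser (fun j => wtt_ j t x)), (fun t x => ser (fun j => wx_ j t x)),
  (fun t x => ser (fun j => wxx_ j t x)); split.
- move=> t x; split.
  + apply: (@ser_is_derive R (fun j s => w_ j s x) (fun j s => wt_ j s x) (Cs * expR (k * (`|t| + 1)))).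
    * by move=> s st; exact: weaken (gw s x) (near_t t s st).
    * by move=> s st; exact: weaken (gwt s x) (near_t t s st).
  + apply: (@ser_is_derive R (fun j s => wt_ j s x) (fun j s => wtt_ j s x) (Cs * expR (k * (`|t| + 1)))).
    * by move=> s st; exact: weaken (gwt s x) (near_t t s st).
    * by move=> s st; exact: weaken (gwtt s x) (near_t t s st).
  + apply: (@ser_is_derive R (fun j v => w_ j t v) (fun j v => wx_ j t v) (Cs * E t)).
    * by move=> v _; exact: gw.
    * by move=> v _; exact: gwx.
  + apply: (@ser_is_derive R (fun j v => wx_ j t v) (fun j v => wxx_ j t v) (Cs * E t)).
    * by move=> v _; exact: gwx.
    * by move=> v _; exact: gwxx.
  rewrite -(serB (gwtt t x) (gwxx t x)).
  have gB : geom_le (Cs * E t + Cs * E t) (fun j => wtt_ j t x - wxx_ j t x).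
    move=> j; apply: le_trans (ler_normB _ _) _; rewrite mulrDl.
    by apply: lerD; [exact: gwtt|exact: gwxx].
  (* After the free wave is split off, the remaining series is minus the potential times the full
     series of [w]. *)
  rewrite (ser_split 1 gB) big_ord_recl big_ord0 eq0 addr0 add0r.
  have -> : (fun j => wtt_ (1 + j)%N t x - wxx_ (1 + j)%N t x) =
      fun j => - p.[cos (pi * x)] * w_ j t x by apply/funext => j; exact: eqS.
  by rewrite (serZ _ (gw t x)) mulNr addNr.
- have init0 (a_ : nat -> nat -> R) (b : nat -> R) x :
      (forall j m, a_ j m = if j is 0 then b m else 0) ->
      geom_le (Cs * E 0) (fun j => sinsum (Len j) (a_ j) x) ->
      ser (fun j => sinsum (Len j) (a_ j) x) = sinsum L b x.
    move=> a_b ga; rewrite (ser_split 1 ga) big_ord_recl big_ord0 addr0.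
    have -> : (fun j => sinsum (Len (1 + j)) (a_ (1 + j)%N) x) = fun=> 0.
      by apply/funext => j; rewrite /sinsum big1// => m _; rewrite a_b mul0r.
    rewrite ser0 addr0 /= /Len mul0n addn0.
    by apply: eq_bigr => m _; rewrite a_b.
  move=> x; split.
    apply: (init0 (fun j m => y j m 0)) => [j m|]; first by rewrite (init j m).1.
    exact: gw.
  apply: (init0 (fun j m => z j m 0)) => [j m|]; first by rewrite (init j m).2.
  exact: gwt.
- move=> t; split; rewrite -[RHS]ser0; congr ser; apply/funext => j; rewrite /w_ /sinsum big1// => m _.
  + by rewrite mulr0 sin0 mulr0.
  + by rewrite mulr1 /freq sin_natpi mulr0.
move=> T; exists (2 * (Cs * expR (k * T))) => t x tT.
have ET : Cs * E t <= Cs * expR (k * T).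
  by rewrite ler_wpM2l// ler_expR ler_pM2l.
by split; apply: ser_le; [exact: weaken (gw t x) ET|exact: weaken (gwt t x) ET].
Qed.

End Terms.
End Wave.

(** * Slow regularisation *)

Section Assembly.
Variable R : realType.

(* Unlike [ge0_le_integral], no measurability is required. *)
Lemma le_integral_nonneg (D : set R) (f1 f2 : R -> \bar R) :
  (forall x, D x -> (0 <= f1 x)%E) -> (forall x, D x -> (f1 x <= f2 x)%E) ->
  (\int[lebesgue_measure]_(x in D) f1 x <= \int[lebesgue_measure]_(x in D) f2 x)%E.
Proof.
move=> f10 f12; rewrite integral_mkcond [leRHS]integral_mkcond.
have f20 x : D x -> (0 <= f2 x)%E by move=> Dx; exact: le_trans (f10 x Dx) (f12 x Dx).
rewrite !ge0_integralTE; [|exact: erestrict_ge0..].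
apply: ereal_sup_le => _ [h hf <-]; exists h => // x.
apply: le_trans (hf x) _; exact: lee_restrict.
Qed.

Lemma L2_le_bounded (g : R -> R) (M : R) :
  (forall x, I01 x -> `|g x| <= M) -> L2_le g M.
Proof.
move=> gM; rewrite /L2_le.
apply: (@le_trans _ _ (\int[lebesgue_measure]_(x in @I01 R) (cst (M ^+ 2)%:E x))%E).
  apply: le_integral_nonneg => x Ix; rewrite lee_fin ?sqr_ge0//.
  rewrite -real_normK ?num_real// lerXn2r ?nnegrE ?gM//.
  exact: le_trans (gM x Ix).
rewrite integral_cst//; last exact: measurable_I01.
have E : lebesgue_measure (@I01 R) = 1%:E.
  rewrite /I01; have := @lebesgue_measure_itv R `]0, 1[.
  by rewrite /= lte_fin ltr01 oppr0 adde0.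
exact: (eq_ind_r (fun z => (M ^+ 2)%:E * z <= (M ^+ 2)%:E)%E
  (eq_ind_r (fun z => z <= (M ^+ 2)%:E)%E (lexx _) (mule1 _)) E).
Qed.

(* [nu e] is the largest [n <= 1/e] whose constant is below the moderate
   threshold [K 0 / e]; the index [0] always qualifies. *)
Lemma slow_index (K : nat -> R) : (forall n, 0 < K n) ->
  exists nu : R -> nat, (forall e, epsrange e -> K (nu e) <= K 0%N * e ^- 1) /\
    nu e @[e --> 0^'+] --> \oo.
Proof.
move=> K0.
pose ok e := [pred n : 'I_(Num.truncn (e^-1)).+1 | K n <= K 0%N * e ^- 1].
pose nu e := (\max_(n in ok e) (n : nat))%N.
exists nu; split.
  move=> e; rewrite /epsrange /= in_itv/= => /andP[e0 e1]; rewrite /nu.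
  have [|i iP ->] := @eq_bigmax_cond _ (ok e) (fun n => n : nat); last exact: iP.
  apply/card_gt0P; exists ord0; rewrite inE/= ler_pMr//.
  by rewrite expr1 invf_ge1.
apply/cvgnyPge => m.
near=> e.
have e0 : 0 < e by near: e; exact: nbhs_right_gt.
have em : e <= m.+1%:R^-1 by near: e; apply: nbhs_right_le; rewrite invr_gt0.
have eK : e <= K 0%N / K m by near: e; apply: nbhs_right_le; rewrite divr_gt0.
have mt : (m < (Num.truncn (e^-1)).+1)%N.
  rewrite ltnS truncn_ge_nat; last by rewrite invr_ge0 ltW.
  apply: (@le_trans _ _ m.+1%:R); first by rewrite ler_nat.
  by rewrite -[m.+1%:R]invrK lef_pV2 ?posrE ?invr_gt0.
apply: (@leq_bigmax_cond _ (ok e) (fun n => n : nat) (Ordinal mt)).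
by rewrite inE/= expr1 ler_pdivlMr// mulrC -ler_pdivlMr.
Unshelve. all: by end_near. Qed.

Lemma smooth_sub (A : set R) (f : R -> R) : smooth_on setT f -> smooth_on A f.
Proof. by move=> sf n x _; exact: sf. Qed.

Lemma smooth_cospi : smooth_on setT (fun x : R => cos (pi * x)).
Proof.
have := @smooth_affine R pi 0 _ (@smooth_cos R).
by under eq_fun do rewrite addr0.
Qed.

Lemma smooth_sinpi : smooth_on setT (fun x : R => sin (pi * x)).
Proof.
have := @smooth_affine R pi 0 _ (@smooth_sin R).
by under eq_fun do rewrite addr0.
Qed.

(** sin (pi x) is the sine sum of the first unit sequence. The length [L] is left free so that both
    initial data can share it. *)
Lemma sinpi_cospi_sinsum (r : {poly R}) L x : ((size r).+1 <= L)%N ->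
  sin (pi * x) * r.[cos (pi * x)] =
  sinsum L (jacobi_horner r (fun m => (m == 0%N)%:R)) x.
Proof.
move=> rL; have v1 : vanishes_from 1 (fun m => (m == 0%N)%:R : R) by case.
rewrite mulrC (sinsum_widen x (@jacobi_horner_vanishes R r 1 _ v1) rL).
rewrite -(sinsum_jacobi_horner r x v1) /sinsum big_ord_recl big_ord0 addr0.
by rewrite /freq !mul1r.
Qed.

Lemma distribution_cosine_polynomials (u : (R -> R) -> R) : distribution01 u ->
  exists p : nat -> {poly R}, forall phi, test_function phi ->
    (fun n => int01 (fun x => (p n).[cos (pi * x)] * phi x)) @ \oo --> u phi.
Proof.
move=> du; have [|||p Hp] := @distribution_cospi_approximation R u (cst 1) (cst 0) 0 du.
- by move=> x; rewrite normr1.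
- by move=> x; rewrite normr0.
- by move=> x _; exact: ltr01.
exists p => phi tphi; have := Hp phi tphi.
by under eq_fun do under [X in int01 X]eq_fun do rewrite mul1r.
Qed.

Lemma distribution_sine_polynomials (u : (R -> R) -> R) : distribution01 u ->
  exists p : nat -> {poly R}, forall phi, test_function phi ->
    (fun n => int01 (fun x => sin (pi * x) * (p n).[cos (pi * x)] * phi x)) @ \oo --> u phi.
Proof.
move=> du.
apply: (@distribution_cospi_approximation R u _ (fun x => pi * cos (pi * x + 0)) pi du).
- move=> x; under eq_fun do rewrite -[pi * _]addr0.
  exact: is_derive_affine.
- by move=> x; exact: sin_max.
- move=> x; rewrite normrM (ger0_norm (pi_ge0 R)) ler_piMr ?pi_ge0//.
  exact: cos_max.
- move=> x /andP[x0 x1]; apply: sin_gt0_pi.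
  by rewrite mulr_gt0 ?pi_gt0//= gtr_pMr ?pi_gt0.
Qed.

Lemma horner_cospi_bounded (p : {poly R}) :
  exists K, forall x : R, `|p.[cos (pi * x)]| <= K.
Proof.
exists (\sum_(i < size p) `|p`_i|) => x; rewrite horner_coef.
apply: le_trans (ler_norm_sum _ _ _) _; apply: ler_sum => i _.
by rewrite normrM ler_piMr// normrX exprn_ile1// cos_max.
Qed.

Lemma regularisation_slow (u : (R -> R) -> R) (g : nat -> R -> R) (nu : R -> nat) :
  (forall n, smooth_on setT (g n)) -> nu e @[e --> 0^'+] --> \oo ->
  (forall phi, test_function phi ->
    (fun n => int01 (fun x => g n x * phi x)) @ \oo --> u phi) ->
  regularisation u (fun e => g (nu e)).
Proof.
move=> sg nuoo gu; split=> [e _|phi tphi]; first exact: smooth_sub.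
exact: (cvg_comp _ _ nuoo (gu phi tphi)).
Qed.

(** As the identities hold on the whole plane, [dt w] and [dx w] are known as functions and can be
    differentiated again; the boundary limits come from continuity across 0 and 1. *)
Lemma wave_solves T (p : {poly R}) L b0 b1 (w wt wtt wx wxx : R -> R -> R) :
  (forall t x : R, [/\ is_derive t 1 (w^~ x) (wt t x),
     is_derive t 1 (wt^~ x) (wtt t x), is_derive x 1 (w t) (wx t x),
     is_derive x 1 (wx t) (wxx t x) &
     wtt t x - wxx t x + p.[cos (pi * x)] * w t x = 0]) ->
  (forall x, w 0 x = sinsum L b0 x /\ wt 0 x = sinsum L b1 x) ->
  (forall t, w t 0 = 0 /\ w t 1 = 0) ->
  dt w = wt /\
  solves T (fun x => p.[cos (pi * x)]) (sinsum L b0) (sinsum L b1) w.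
Proof.
move=> wD w0 wb.
have dtE : dt w = wt.
  apply/funext => t; apply/funext => x; have [h _ _ _ _] := wD t x.
  exact: is_derive_derive1 h.
have dtwtE t x : dt wt t x = wtt t x.
  by have [_ h _ _ _] := wD t x; exact: is_derive_derive1 h.
have dxE t : dx w t = wx t.
  apply/funext => x; have [_ _ h _ _] := wD t x.
  exact: is_derive_derive1 h.
have dxxE t x : dx (dx w) t x = wxx t x.
  have [_ _ _ h _] := wD t x; rewrite /dx -(is_derive_derive1 h).
  by congr (derive1 _ x); exact: dxE.
split=> //; split.
- move=> t x _ _; have [h1 h2 h3 h4 h5] := wD t x; split.
  + by have [] := h1.
  + by rewrite dtE; have [] := h2.
  + by have [] := h3.
  + by rewrite dxE; have [] := h4.
  + by rewrite dtE dtwtE dxxE.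
- by move=> x _; rewrite dtE; exact: w0.
move=> t _; have cw x : w t y @[y --> x] --> w t x.
  by have [_ _ h _ _] := wD t x; exact: is_derive_continuous h.
have [w00 w10] := wb t.
split.
  by have := cvg_at_right_filter (cw 0); rewrite w00.
by have := cvg_at_left_filter (cw 1); rewrite w10.
Qed.

End Assembly.

Theorem theorem3 (R : realType) (q u0 u1 : (R -> R) -> R) (T : R) :
  distribution01 q -> distribution01 u0 -> distribution01 u1 -> 0 < T ->
  exists u : R -> R -> R -> R, very_weak_solution T q u0 u1 u.
Proof.
move=> dq du0 du1 T0.
have [p Hp] := distribution_cosine_polynomials dq.
have [r0 Hr0] := distribution_sine_polynomials du0.
have [r1 Hr1] := distribution_sine_polynomials du1.
pose g0 n x := sin (pi * x) * (r0 n).[cos (pi * x)].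
pose g1 n x := sin (pi * x) * (r1 n).[cos (pi * x)].
(* A single constant per index bounds the potential, the solution and its time derivative, so that
   one slow index serves all nets. *)
have /choice[wK HwK] : forall n, exists wK : (R -> R -> R) * R,
    [/\ solves T (fun x => (p n).[cos (pi * x)]) (g0 n) (g1 n) wK.1, 0 < wK.2,
      forall x, `|(p n).[cos (pi * x)]| <= wK.2 &
      forall t x, 0 <= t <= T -> `|wK.1 t x| <= wK.2 /\ `|dt wK.1 t x| <= wK.2].
  move=> n; pose e0 m : R := (m == 0%N)%:R.
  have v1 : vanishes_from 1 e0 by case.
  pose L := (size (r0 n) + size (r1 n)).+1.
  have v (r : {poly R}) : ((size r).+1 <= L)%N -> vanishes_from L (jacobi_horner r e0).
    by move=> rL m Lm; apply: (@jacobi_horner_vanishes R r 1 _ v1); exact: leq_trans Lm.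
  have L0 : ((size (r0 n)).+1 <= L)%N by rewrite ltnS leq_addr.
  have L1 : ((size (r1 n)).+1 <= L)%N by rewrite ltnS leq_addl.
  have [w [wt [wtt [wx [wxx [wD w0 wb wB]]]]]] := wave_solution (p n) (v _ L0) (v _ L1).
  have [dtE sol] := wave_solves T wD w0 wb.
  have [K HK] := wB T; have [K' HK'] := horner_cospi_bounded (p n).
  have K0 : 0 <= K.
    have [|h _] := HK 0 0; first by rewrite normr0 ltW.
    exact: le_trans h.
  have K0' : 0 <= K' by apply: le_trans (HK' 0).
  exists (w, K + K' + 1); split => /=.
  - have -> : g0 n = sinsum L (jacobi_horner (r0 n) e0).
      by apply/funext => x; exact: sinpi_cospi_sinsum.
    have -> : g1 n = sinsum L (jacobi_horner (r1 n) e0).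
      by apply/funext => x; exact: sinpi_cospi_sinsum.
    exact: sol.
  - lra.
  - by move=> x; apply: le_trans (HK' x) _; lra.
  - move=> t x /andP[t0 tT]; rewrite dtE.
    have [|h1 h2] := HK t x; first by rewrite ger0_norm.
    by split; [apply: le_trans h1 _|apply: le_trans h2 _]; lra.
have K0 n : 0 < (wK n).2 by have [] := HwK n.
have [nu [nuK nuoo]] := slow_index K0.
exists (fun e => (wK (nu e)).1).
exists (fun e x => (p (nu e)).[cos (pi * x)]), (fun e => g0 (nu e)), (fun e => g1 (nu e)).
have T00 : (0 : R) <= 0 <= T by rewrite lexx ltW.
split.
- split; last first.
    exists 1%N, (wK 0%N).2; split => // e he x _.
    by have [_ _ h _] := HwK (nu e); exact: le_trans (h x) (nuK e he).
  apply: (regularisation_slow (g := fun n x => (p n).[cos (pi * x)])) => //.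
  by move=> n; apply: smooth_horner; exact: smooth_cospi.
- split.
    apply: (regularisation_slow (g := g0)) => // n.
    by apply: smooth_mul; [exact: smooth_sinpi|apply: smooth_horner; exact: smooth_cospi].
  (* The data are the solution and its time derivative at time 0, so they inherit the bound of the
     solution. *)
  exists 1%N, (wK 0%N).2; split => // e he; apply: L2_le_bounded => x Ix.
  have [[_ i _] _ _ h] := HwK (nu e).
  by rewrite -(i x Ix).1; exact: le_trans (h 0 x T00).1 (nuK e he).
- split.
    apply: (regularisation_slow (g := g1)) => // n.
    by apply: smooth_mul; [exact: smooth_sinpi|apply: smooth_horner; exact: smooth_cospi].
  exists 1%N, (wK 0%N).2; split => // e he; apply: L2_le_bounded => x Ix.
  have [[_ i _] _ _ h] := HwK (nu e).
  by rewrite -(i x Ix).2; exact: le_trans (h 0 x T00).2 (nuK e he).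
- by move=> e _; have [] := HwK (nu e).
split; exists 1%N, (wK 0%N).2; split => // e he t tT; apply: L2_le_bounded => x Ix;
  have [_ _ _ h] := HwK (nu e).
  exact: le_trans (h t x tT).1 (nuK e he).
exact: le_trans (h t x tT).2 (nuK e he).
Qed.
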